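(* Suppose that $\mathcal{H}^1(S_\lambda)<\infty$ for all $\lambda\in[0,a)$. For $x,y\in\mathcal{C}$ the problem $d(x,y)=\inf_{\gamma\in\Gamma^{xy}}L(\gamma)$ has a minimizer if $d(x,y)$ is finite. Moreover, at least one minimizer $\psi$ is injective and satisfies $$\mathrm{len}(\psi)\le\begin{cases}\mathcal{H}^1(S_1)+d(x,y)&\text{if }a=\infty,\\ \mathcal{H}^1(S_{a/2})+\frac{2}{a}d(x,y)&\text{if }a<\infty.\end{cases}$$
   Context: $I=[0,1]$, $\mathcal{C}=[-1,1]^n$, $\mathcal{L}$ is the one-dimensional Lebesgue measure and $\mathcal{H}^1$ the one-dimensional Hausdorff measure. A set is countably $1$-rectifiable if it is a countable union of Lipschitz images of bounded subsets of $\mathbb{R}$. Fixed: $S\subset\mathcal{C}$ countably $1$-rectifiable and Borel measurable, $a\in[0,\infty]$, $b:S\to[0,\infty)$ lower semi-continuous with $b\le a$ on $S$; $b$ is extended to $\mathcal{C}$ by $b=a$ on $\mathcal{C}\setminus S$. $S_\lambda=\{z\in S\,|\,b(z)\le\lambda\}$. $\Gamma^{xy}$ is the set of Lipschitz paths $\gamma:I\to\mathcal{C}$ with $\gamma(0)=x$, $\gamma(1)=y$. $L(\gamma)=\int_I b(\gamma)|\dot\gamma|\,\mathrm{d}\mathcal{L}$ (convention $0\cdot\infty=0$), $\mathrm{len}(\gamma)=\int_I|\dot\gamma|\,\mathrm{d}\mathcal{L}$. The urban metric is $d(x,y)=\inf_{\gamma\in\Gamma^{xy}}\int_{\gamma(I)}b\,\mathrm{d}\mathcal{H}^1$,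 which equals $\inf_{\gamma\in\Gamma^{xy}}L(\gamma)$.
   Formalization: Injectivity of the minimizer is asserted only for x ≠ y (for x = y every path has ψ(0)=ψ(1), so none is injective), and the length bound for a<∞ only for a>0, since 2/a is undefined at a=0. *)

(* Defs.v *)
(* MathComp-Analysis; vectors of R^n are row vectors 'rV[R]_n. *)
From HB Require Import structures.
From mathcomp Require Import all_boot all_order all_algebra.
From mathcomp Require Import all_classical all_reals all_analysis.

Set Implicit Arguments.
Unset Strict Implicit.
Unset Printing Implicit Defensive.

Import Order.TTheory GRing.Theory Num.Theory.
Import numFieldNormedType.Exports.

Local Open Scope classical_set_scope.
Local Open Scope ring_scope.
Local Open Scope ereal_scope.

Section hausdorff.
Context {R : realType} {n : nat}.
Local Notation V := 'rV[R]_n.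
Implicit Types (A : set V) (d : R).

(* The library's norm `|v| on 'rV[R]_n is the maximum norm, whereas lengths and
   diameters below are Euclidean. *)
Definition enorm (v : V) : R := Num.sqrt (\sum_(i < n) (v ord0 i) ^+ 2)%R.

(* The element 0 makes the diameter of the empty set 0 rather than -oo. *)
Definition diam A : \bar R :=
  ereal_sup (0 |` [set (enorm (p.1 - p.2))%:E | p in A `*` A]).

Definition small_cover d A : set (set V)^nat :=
  [set F | (forall i, diam (F i) <= d%:E) /\ A `<=` \bigcup_i F i].

Definition hausdorff1_content d A : \bar R :=
  ereal_inf [set \sum_(i <oo) diam (F i) | F in small_cover d A].

(* In dimension 1 the normalizing factor omega_1 / 2 is 1. *)
Definition hausdorff1 A : \bar R :=
  ereal_sup [set hausdorff1_content d A | d in [set d | (0 < d)%R]].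

Lemma diam_ge0 A : 0 <= diam A.
Proof. by apply: ereal_sup_ubound; left. Qed.
Hint Resolve diam_ge0 : core.

Lemma diam0 : diam set0 = 0.
Proof.
apply/eqP; rewrite eq_le diam_ge0 andbT.
by apply: ge_ereal_sup => e [->|[p []]].
Qed.

Lemma hausdorff1_content_ge0 d A : 0 <= hausdorff1_content d A.
Proof. by apply: le_ereal_inf_tmp => _ [F _ <-]; exact: nneseries_ge0. Qed.

Lemma hausdorff1_content_sigma_subadditive d :
  sigma_subadditive (hausdorff1_content d).
Proof.
move=> A; have [[i ioo]|] :=
    pselect (exists i, hausdorff1_content d (A i) = +oo).
  rewrite (eseries_pinfty _ _ ioo) ?leey// => m _.
  by rewrite -ltNye (lt_le_trans _ (hausdorff1_content_ge0 _ _)).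
rewrite -forallNE => Aoo.
suff add2e (e : {posnum R}) : hausdorff1_content d (\bigcup_i A i) <=
    \sum_(i <oo) hausdorff1_content d (A i) + e%:num%:E.
  by apply/lee_addgt0Pr => _/posnumP[].
rewrite (le_trans _ (epsilon_trick _ _ _))//; last first.
  by move=> m; exact: hausdorff1_content_ge0.
pose P m (B : (set V)^nat) := small_cover d (A m) B /\
  \sum_(k <oo) diam (B k) <=
    hausdorff1_content d (A m) + (e%:num / (2 ^ m.+1)%:R)%:E.
have [G PG] : {G : ((set V)^nat)^nat & forall m, P m (G m)}.
  apply: (@choice _ _ P) => m; rewrite /P /hausdorff1_content.
  set S := (X in ereal_inf X); move infS : (ereal_inf S) => iS.
  case: iS infS => [r Sr|Soo|Soo].
  - have en1 : (0 < e%:num / (2 ^ m.+1)%:R)%R by [].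
    have /(lb_ereal_inf_adherent en1) : ereal_inf S \is a fin_num by rewrite Sr.
    move=> [x [B cB muBx] xS].
    by exists B; split => //; rewrite muBx -Sr; exact/ltW.
  - by have := Aoo m; rewrite /hausdorff1_content Soo.
  - suff : lbound S 0 by move/le_ereal_inf_tmp; rewrite Soo.
    by move=> /= _ [B _ <-]; exact: nneseries_ge0.
have G_ge0 x : 0 <= (diam \o uncurry G) x by exact: diam_ge0.
apply: (@le_trans _ _ (\esum_(i in setT) (diam \o uncurry G) i)).
  apply: ereal_inf_lbound => /=.
  have /card_esym/ppcard_eqP[f] := card_nat2.
  exists (uncurry G \o f).
    split => [i|] /=.
      by case: (f i) => j k; exact: (PG j).1.1.
    move=> t [i _] /(PG i).1.2 [j _ Bijt]; exists (f^-1%FUN (i, j)) => //=.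
    by rewrite invK ?inE.
  rewrite -(esum_pred_image (diam \o uncurry G) _ xpredT) ?[fun=> _]set_true//.
  by rewrite image_eq.
rewrite (_ : esum _ _ = \sum_(i <oo) \sum_(j <oo) diam (G i j)); last first.
  pose J : nat -> set (nat * nat) := fun i => [set (i, j) | j in setT].
  rewrite (_ : setT = \bigcup_k J k); last first.
    by rewrite predeqE => -[a b]; split => // _; exists a => //; exists b.
  rewrite esum_bigcupT /=; last 2 first.
    - apply/trivIsetP => i j _ _ ij.
      rewrite predeqE => -[k m] /=; split => //= -[] [_] _ [<-{k} _].
      by move=> [m' _] [] /esym/eqP; rewrite (negbTE ij).
    - by move=> /= [k m]; exact: diam_ge0.
  rewrite -(image_id [set: nat]) -fun_true esum_pred_image//; last first.
    by move=> k _; exact: esum_ge0.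
  apply: eq_eseriesr => /= j _.
  rewrite -(esum_pred_image (diam \o uncurry G) (pair j) predT)//=; last first.
    by move=> ? ? _ _; exact: (@can_inj _ _ _ snd).
  by congr esum; rewrite predeqE => -[a b]; split; move=> [i _ <-]; exists i.
apply: lee_lim.
- by apply: is_cvg_nneseries => k *; exact: nneseries_ge0.
- by apply: is_cvg_nneseries => k *; apply: adde_ge0 => //;
    exact: hausdorff1_content_ge0.
- by near=> k; apply: lee_sum => i _; exact: (PG i).2.
Unshelve. all: by end_near. Qed.

Lemma hausdorff1_content_le d A : (0 < d)%R ->
  hausdorff1_content d A <= hausdorff1 A.
Proof. by move=> d0; apply: ereal_sup_ubound; exists d. Qed.

Lemma hausdorff1_ge0 A : 0 <= hausdorff1 A.
Proof.
exact: le_trans (hausdorff1_content_ge0 1 A) (hausdorff1_content_le A ltr01).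
Qed.

Lemma hausdorff10 : hausdorff1 set0 = 0.
Proof.
apply/eqP; rewrite eq_le hausdorff1_ge0 andbT.
apply: ge_ereal_sup => _ [d /= d0 <-]; apply: ereal_inf_lbound.
exists (fun=> set0); first by split => // _; rewrite diam0 lee_fin ltW.
by rewrite eseries0// => *; rewrite diam0.
Qed.

Lemma le_hausdorff1 : {homo hausdorff1 : A B / A `<=` B >-> A <= B}.
Proof.
move=> A B AB; apply: ge_ereal_sup => _ [d /= d0 <-].
apply: le_trans (hausdorff1_content_le B d0).
apply/ereal_inf_le_tmp => _ [F [dF BF] <-]; exists F => //; split => //.
exact: subset_trans AB BF.
Qed.

Lemma hausdorff1_sigma_subadditive : sigma_subadditive hausdorff1.
Proof.
move=> F; apply: ge_ereal_sup => _ [d /= d0 <-].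
apply: le_trans (hausdorff1_content_sigma_subadditive _ _) _.
apply: lee_nneseries => i *; first exact: hausdorff1_content_ge0.
exact: hausdorff1_content_le.
Qed.

HB.instance Definition _ := isOuterMeasure.Build R V hausdorff1
  hausdorff10 hausdorff1_ge0 le_hausdorff1 hausdorff1_sigma_subadditive.

(* The restriction to the Caratheodory sigma-algebra, which contains the Borel
   sets since hausdorff1 is a metric outer measure. *)
Definition hausdorff1_measure :
  set (caratheodory_type (@hausdorff1 : set V -> \bar R)) -> \bar R := hausdorff1.

HB.instance Definition _ := isMeasure.Build _ _ _ hausdorff1_measure
  (@caratheodory_measure0 R V hausdorff1)
  (@caratheodory_measure_ge0 R V hausdorff1)
  (@caratheodory_measure_sigma_additive R V hausdorff1).

End hausdorff.

Section urban_metric.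
Context {R : realType} {n : nat}.
Local Notation V := 'rV[R]_n.
Implicit Types (S : set V) (a : \bar R) (b : V -> R) (x y : V) (g : R -> V).

Definition cube : set V := [set z | forall i, (-1 <= z ord0 i <= 1)%R].

(* The Lipschitz property does not depend on the norm chosen on R^n. *)
Definition countably_1_rectifiable S :=
  exists (A : (set R)^nat) (f : nat -> R -> V),
    (forall k, bounded_set (A k) /\ [lipschitz f k t | t in A k]) /\
    S = \bigcup_k (f k @` A k).

(* Only the values of b on S are used. *)
Definition extend S a b (z : V) : \bar R := if z \in S then (b z)%:E else a.

Definition sublevel S b (l : R) : set V := [set z | S z /\ (b z <= l)%R].

(* Paths are functions on R of which only the values on [0, 1] matter. *)
Definition lip_paths x y : set (R -> V) :=
  [set g : R -> V | [/\ [lipschitz g t | t in `[0%R, 1%R]],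
    g @` `[0%R, 1%R] `<=` cube, g 0%R = x & g 1%R = y]].

(* By Rademacher's theorem derive1 g is the derivative of a Lipschitz path g almost
   everywhere on [0, 1]. *)
Definition len g : \bar R :=
  \int[lebesgue_measure]_(t in `[0%R, 1%R]) (enorm (derive1 g t))%:E.

(* Products in \bar R follow the convention 0 * +oo = 0. *)
Definition path_cost S a b g : \bar R :=
  \int[lebesgue_measure]_(t in `[0%R, 1%R])
    (extend S a b (g t) * (enorm (derive1 g t))%:E).

Definition image_cost S a b g : \bar R :=
  \int[hausdorff1_measure]_(z in g @` `[0%R, 1%R]) extend S a b z.

Definition urban_metric S a b x y : \bar R :=
  ereal_inf [set image_cost S a b g | g in lip_paths x y].

Definition is_minimizer S a b x y g :=
  [/\ lip_paths x y g, path_cost S a b g = urban_metric S a b x y &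
    forall h, lip_paths x y h -> path_cost S a b g <= path_cost S a b h].

End urban_metric.

(* Main.v *)
Require Import Defs.
From HB Require Import structures.
From mathcomp Require Import all_boot all_order all_algebra.
From mathcomp Require Import all_classical all_reals all_analysis.
From mathcomp Require Import measurable_realfun ring lra.

(** The cost of a path can be measured on its parameter interval (path cost) or
on its image (image cost).  The image cost of any Lipschitz path is at most its
path cost ([lip_path_integral_le]).  Equality holds for an arc psi of constant
speed, in the sense that psi is l-Lipschitz and its image has Hausdorff measure
exactly l: then H on psi(I) is the image of l times Lebesgue measure, and
|psi'| <= l.  So it suffices to find such an arc whose image cost is d(x, y).

Arcs inside images.  In a compact set E the curves from x to y, if there are
any, have a smallest Lipschitz constant l, and it is attained
([exists_shortest]).  If x <> y, a curve attaining it is injective, as cutting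
out a loop would lower the constant.  In any case its image has measure l, as
reparametrising it by the measure of the part of the image already covered would
otherwise lower the constant ([shortest_injective], [shortest_hausdorff1]).  With E the image of
a path this replaces any path by an arc of constant speed without increasing
the image cost ([exists_arc_in_path]).

Length bound.  Outside S_r the cost is at least r as soon as r <= a, so
H(D) <= H(S_r) + (1/r) times the integral of the cost over D
([hausdorff1_le_sublevel]).  If a > 0 (otherwise all costs vanish), some r < a
bounds in this way the lengths of the arcs of a minimizing sequence; for r = 1
and r = a/2 it gives the two estimates.

Lower semicontinuity.  A minimizing sequence of arcs f_k with Lipschitz
constants L_k thus has a subsequence with L_k -> l that converges pointwise to
an l-Lipschitz curve g ([curve_subsequence]).  The cost need not be lower
semicontinuous on the cube, because the sublevel sets S_r need not be closed.
But H(S_r) is finite for r < a, so S_r contains a closed set K with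
H(S_r \ K) < e.  Each f_k spends mass at most e in S_r \ K, since its mass is
the restriction of H to its image; and the mass which a curve spends in the open
complement of K is lower semicontinuous under pointwise convergence.  Hence so
is, for every r, the mass spent where the cost exceeds r ([superlevel_lsc]), and
summing over levels shows that the image cost of g is at most d(x, y)
([limit_image_cost]).  An arc inside the image of g is the minimizer.

The measure theory below serves these arguments: H is additive on Borel sets
([borel_caratheodory]), the part of a path lying in a Borel set B has H-measure
at most the amount of its variation spent in B ([hausdorff1_path_borel]), and a
Lipschitz path is differentiable almost everywhere and moves between two times
by at most the integral of its speed ([elipschitz_speed]). *)

Set Implicit Arguments.
Unset Strict Implicit.
Unset Printing Implicit Defensive.

Import Order.TTheory GRing.Theory Num.Theory.
Import numFieldNormedType.Exports.

Local Open Scope classical_set_scope.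
Local Open Scope ring_scope.

(** * The Euclidean norm *)

Lemma lip_continuous (K : realFieldType) (U W : normedModType K) (k : K)
    (f : U -> W) : (forall p q, `|f p - f q| <= k * `|p - q|) -> continuous f.
Proof.
move=> fk p; apply/cvgrPdist_lt => e e0; near=> q.
apply: le_lt_trans (fk p q) _.
have k0 : 0 < `|k| + 1 by rewrite ltr_wpDl.
apply: (@le_lt_trans _ _ ((`|k| + 1) * `|p - q|)).
  by rewrite ler_wpM2r// (le_trans (ler_norm k))// lerDl.
rewrite mulrC -ltr_pdivlMr//; near: q.
by apply: cvgr_dist_lt; [exact: cvg_id|rewrite divr_gt0].
Unshelve. all: by end_near. Qed.

Section euclidean_norm.
Context {R : realType} {n : nat}.
Local Notation V := 'rV[R]_n.
Implicit Types u v w : V.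

Lemma enorm_ge0 v : 0 <= enorm v.
Proof. exact: sqrtr_ge0. Qed.

Lemma sqr_enorm v : enorm v ^+ 2 = \sum_(i < n) v ord0 i ^+ 2.
Proof. by rewrite sqr_sqrtr// sumr_ge0// => i _; rewrite sqr_ge0. Qed.

Lemma enormZ (k : R) v : enorm (k *: v) = `|k| * enorm v.
Proof.
rewrite /enorm -sqrtr_sqr -sqrtrM ?sqr_ge0// mulr_sumr.
by congr Num.sqrt; apply: eq_bigr => i _; rewrite mxE exprMn.
Qed.

Lemma enormN v : enorm (- v) = enorm v.
Proof. by rewrite -scaleN1r enormZ normrN normr1 mul1r. Qed.

Lemma enorm0 : enorm (0 : V) = 0.
Proof. by rewrite -(scale0r (0 : V)) enormZ normr0 mul0r. Qed.

Lemma enormC u v : enorm (u - v) = enorm (v - u).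
Proof. by rewrite -opprB enormN. Qed.

Lemma coord_le_enorm v i : `|v ord0 i| <= enorm v.
Proof.
rewrite -(@ler_pXn2r _ 2)// ?nnegrE ?enorm_ge0// sqr_enorm real_normK ?num_real//.
by rewrite (bigD1 i)//= lerDl sumr_ge0// => j _; rewrite sqr_ge0.
Qed.

Lemma enorm_eq0 v : enorm v = 0 -> v = 0.
Proof.
move=> v0; apply/rowP => i; rewrite mxE; apply/eqP.
by rewrite -normr_le0 -v0 coord_le_enorm.
Qed.

Lemma norm_le_enorm v : `|v| <= enorm v.
Proof.
rewrite [leLHS]/Num.Def.normr /= mx_normrE; apply/bigmax_leP; split.
  exact: enorm_ge0.
by move=> [i j] _ /=; rewrite ord1 coord_le_enorm.
Qed.

Lemma coord_le_norm v i : `|v ord0 i| <= `|v|.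
Proof.
by rewrite [leRHS]/Num.Def.normr /= mx_normrE (le_bigmax _ (fun ij => `|v ij.1 ij.2|) (ord0, i)).
Qed.

Lemma enorm_le_norm v : enorm v <= n%:R * `|v|.
Proof.
rewrite -(@ler_pXn2r _ 2)// ?nnegrE ?enorm_ge0 ?mulr_ge0// sqr_enorm.
apply: (@le_trans _ _ (\sum_(i < n) `|v| ^+ 2)).
  apply: ler_sum => i _; rewrite -[leLHS]real_normK ?num_real//.
  by rewrite lerXn2r ?nnegrE// coord_le_norm.
rewrite sumr_const card_ord exprMn -[leLHS]mulr_natl ler_wpM2r ?sqr_ge0//.
by rewrite -natrX ler_nat; case: (n) => // k; rewrite expnS leq_pmulr.
Qed.

(** With A = |u| and B = |v|, the sum of the squares of B u_i - A v_i is
    nonnegative and equals 2 A B (A B - <u, v>). *)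
Lemma cauchy_schwarz_sum u v :
  \sum_(i < n) u ord0 i * v ord0 i <= enorm u * enorm v.
Proof.
have [/enorm_eq0->|u0] := eqVneq (enorm u) 0.
  by rewrite enorm0 mul0r big1// => i _; rewrite mxE mul0r.
have [/enorm_eq0->|v0] := eqVneq (enorm v) 0.
  by rewrite enorm0 mulr0 big1// => i _; rewrite mxE mulr0.
have {}u0 : 0 < enorm u by rewrite lt_neqAle eq_sym u0 enorm_ge0.
have {}v0 : 0 < enorm v by rewrite lt_neqAle eq_sym v0 enorm_ge0.
set A := enorm u; set B := enorm v; set s := \sum_(i < n) _.
have : 0 <= \sum_(i < n) (B * u ord0 i - A * v ord0 i) ^+ 2.
  by apply: sumr_ge0 => i _; exact: sqr_ge0.
rewrite (eq_bigr (fun i => B ^+ 2 * u ord0 i ^+ 2 + A ^+ 2 * v ord0 i ^+ 2 -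
    2 * A * B * (u ord0 i * v ord0 i))); last by move=> i _; ring.
rewrite sumrB big_split/= -!mulr_sumr -!sqr_enorm -/A -/B -/s.
rewrite (_ : _ - _ = 2 * A * B * (A * B - s)); last by ring.
by rewrite pmulr_rge0 ?subr_ge0// !mulr_gt0.
Qed.

Lemma ler_enormD u v : enorm (u + v) <= enorm u + enorm v.
Proof.
rewrite -(@ler_pXn2r _ 2)// ?nnegrE ?enorm_ge0 ?addr_ge0 ?enorm_ge0//.
rewrite sqr_enorm (eq_bigr (fun i => u ord0 i ^+ 2 + v ord0 i ^+ 2 +
    2 * (u ord0 i * v ord0 i))); last by move=> i _; rewrite mxE; ring.
rewrite !big_split/= -mulr_sumr -!sqr_enorm sqrrD.
have := cauchy_schwarz_sum u v; lra.
Qed.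

Lemma ler_enormB_trans w u v : enorm (u - v) <= enorm (u - w) + enorm (w - v).
Proof. by have := ler_enormD (u - w) (w - v); rewrite addrA subrK. Qed.

Lemma ler_dist_enorm (p q : V) : `|enorm p - enorm q| <= enorm (p - q).
Proof.
have := ler_enormD (p - q) q; have := ler_enormD (q - p) p.
by rewrite !subrK (enormC q p) ler_norml => qp pq; apply/andP; split; lra.
Qed.

Lemma enorm_continuous : continuous (@enorm R n).
Proof.
apply: (@lip_continuous _ _ _ n%:R) => p p'.
exact: le_trans (ler_dist_enorm _ _) (enorm_le_norm _).
Qed.

End euclidean_norm.

(** * Borel sets are Caratheodory measurable for the Hausdorff measure *)

Section diameter.
Context {R : realType} {n : nat}.
Local Notation V := 'rV[R]_n.
Implicit Types A B : set V.
Local Open Scope ereal_scope.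

Lemma enorm_le_diam A p q : A p -> A q -> (enorm (p - q))%:E <= diam A.
Proof. by move=> Ap Aq; apply: ereal_sup_ubound; right; exists (p, q). Qed.

Lemma diam_le A (r : \bar R) : 0 <= r ->
  (forall p q, A p -> A q -> (enorm (p - q))%:E <= r) -> diam A <= r.
Proof.
by move=> r0 Ar; apply: ge_ereal_sup => _ [->//|[[p q] [/= Ap Aq] <-]]; exact: Ar.
Qed.

Lemma le_diam A B : A `<=` B -> diam A <= diam B.
Proof.
by move=> AB; apply: diam_le (diam_ge0 _) _ => p q Ap Aq;
  apply: enorm_le_diam; exact: AB.
Qed.

Lemma hausdorff1_contentS (d1 d2 : R) A : (d1 <= d2)%R ->
  hausdorff1_content d2 A <= hausdorff1_content d1 A.
Proof.
move=> d12; apply: ereal_inf_le_tmp => _ [F [Fd AF] <-]; exists F => //.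
by split=> // i; apply: le_trans (Fd i) _; rewrite lee_fin.
Qed.

(** A set of diameter at most d < r meets at most one of A and B, so a cover of
    the union splits into a cover of A and a cover of B. *)
Lemma hausdorff1_content_separated (d r : R) A B : (d < r)%R ->
  (forall p q, A p -> B q -> (r <= enorm (p - q))%R) ->
  hausdorff1_content d A + hausdorff1_content d B <=
  hausdorff1_content d (A `|` B).
Proof.
move=> dr ABr; apply: le_ereal_inf_tmp => _ [F [Fd ABF] <-].
apply: (@le_trans _ _ (\sum_(i <oo) (diam (F i `&` A) + diam (F i `&` B)))).
  rewrite nneseriesD//; try by move=> *; exact: diam_ge0.
  apply: leeD; apply: ereal_inf_lbound.
    exists (fun i => F i `&` A) => //; split => [i|].
      by apply: le_trans (Fd i); exact: le_diam (@subIsetl _ _ _).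
    by move=> p Ap; have [i _ Fip] := ABF p (or_introl Ap); exists i.
  exists (fun i => F i `&` B) => //; split => [i|].
    by apply: le_trans (Fd i); exact: le_diam (@subIsetl _ _ _).
  by move=> p Bp; have [i _ Fip] := ABF p (or_intror Bp); exists i.
apply: lee_nneseries => [i _|i _]; first by rewrite adde_ge0 ?diam_ge0.
have [->|/set0P[p [Fp Ap]]] := eqVneq (F i `&` A) set0.
  by rewrite diam0 add0e; exact: le_diam (@subIsetl _ _ _).
have [->|/set0P[q [Fq Bq]]] := eqVneq (F i `&` B) set0.
  by rewrite diam0 adde0; exact: le_diam (@subIsetl _ _ _).
have := le_trans (enorm_le_diam Fp Fq) (Fd i).
by rewrite lee_fin leNgt (lt_le_trans dr)// ABr.
Qed.

(** The Hausdorff outer measure is a metric outer measure: separated sets cannot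
    share small covering sets. *)
Lemma hausdorff1_separated (r : R) A B : (0 < r)%R ->
  (forall p q, A p -> B q -> (r <= enorm (p - q))%R) ->
  hausdorff1 A + hausdorff1 B <= hausdorff1 (A `|` B).
Proof.
move=> r0 ABr.
have [|] := eqVneq (hausdorff1 (A `|` B)) +oo; first by move->; rewrite leey.
rewrite -ltey => Hoo.
have Hfin C : C `<=` A `|` B -> hausdorff1 C \is a fin_num.
  move=> CAB; rewrite ge0_fin_numE ?hausdorff1_ge0//.
  exact: le_lt_trans (le_hausdorff1 CAB) Hoo.
have HB := Hfin _ (@subsetUr _ A B).
rewrite -leeBrDr//; apply: ge_ereal_sup => _ [d1 /= d10 <-].
rewrite leeBrDr//.
have c1fin : hausdorff1_content d1 A \is a fin_num.
  rewrite ge0_fin_numE ?hausdorff1_content_ge0//.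
  apply: le_lt_trans (hausdorff1_content_le A d10) _.
  by apply: le_lt_trans (le_hausdorff1 _) Hoo => x; left.
rewrite -leeBrDl//; apply: ge_ereal_sup => _ [d2 /= d20 <-]; rewrite leeBrDl//.
pose d : R := Num.min (r / 2)%R (Num.min d1 d2).
have d0 : (0 < d)%R by rewrite !lt_min d10 d20 divr_gt0.
apply: (@le_trans _ _ (hausdorff1_content d A + hausdorff1_content d B)).
  by apply: leeD; apply: hausdorff1_contentS; rewrite !ge_min lexx ?orbT.
apply: le_trans (hausdorff1_content_le _ d0).
apply: hausdorff1_content_separated ABr.
by rewrite gt_min ltr_pdivrMr// ltr_pMr// ltr1n.
Qed.

Lemma hausdorff1_set1 (p : V) : hausdorff1 [set p] = 0.
Proof.
apply/eqP; rewrite eq_le hausdorff1_ge0 andbT.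
apply: ge_ereal_sup => _ [d /= d0 <-]; apply: ereal_inf_lbound.
have p0 : diam [set p] = 0.
  apply/eqP; rewrite eq_le diam_ge0 andbT.
  by apply: diam_le => // _ _ -> ->; rewrite subrr enorm0.
exists (fun=> [set p]); last by rewrite eseries0.
by split; [move=> _; rewrite p0 lee_fin ltW|move=> x; exists 0%N].
Qed.

End diameter.

Section far_from.
Context {R : realType} {n : nat}.
Local Notation V := 'rV[R]_n.

(** The set of points at distance at least 1/(k+1) from F, written without a
    distance function so that it also makes sense for empty F. *)
Definition far (F : set V) k := [set p : V | forall q, F q -> k.+1%:R^-1 <= enorm (p - q)].

Lemma farS F k : far F k `<=` far F k.+1.
Proof.
move=> p Fp q Fq; apply: le_trans (Fp q Fq).
by rewrite lef_pV2 ?posrE// ler_nat.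
Qed.

Lemma far_disjoint F k : far F k `<=` ~` F.
Proof.
by move=> p Fp /Fp; rewrite subrr enorm0 leNgt invr_gt0 ltr0n.
Qed.

Lemma exists_far F p : closed F -> ~ F p -> exists k, far F k p.
Proof.
move=> Fcl nFp.
have /nbhs_normP[e /= e0 pe] : nbhs p (~` F).
  by apply: open_nbhs_nbhs; split => //; exact: closed_openC.
exists (Num.truncn e^-1) => q Fq; rewrite leNgt; apply/negP => pq.
apply: (pe q) => //=; apply: le_lt_trans (norm_le_enorm _) _.
apply: lt_trans pq _; rewrite invf_plt ?posrE//.
exact: Num.Theory.truncnS_gt.
Qed.

Lemma enormB_continuous (q : V) : continuous (fun p : V => enorm (p - q)).
Proof.
apply: (@lip_continuous _ _ _ n%:R) => p p'.
apply: le_trans (ler_dist_enorm _ _) _.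
by rewrite opprB addrA subrK enorm_le_norm.
Qed.

Lemma closed_far F k : closed (far F k).
Proof.
rewrite (_ : far F k = \bigcap_(q in F) [set p | k.+1%:R^-1 <= enorm (p - q)]) //.
apply: closed_bigI => q _.
change (closed ((fun p : V => enorm (p - q)) @^-1` [set r | k.+1%:R^-1 <= r])).
by apply: preimage_closed; [move=> p _; exact: enormB_continuous|exact: closed_ge].
Qed.

End far_from.

Section caratheodory.
Context {R : realType} {n : nat}.
Local Notation V := 'rV[R]_n.
Local Open Scope ereal_scope.

Let annulus (X F : set V) k := (X `&` far F k.+1) `\` far F k.

(** Annuli whose indices differ by two are separated by a positive distance, so
    H is additive on the annuli of one parity; [o] selects the parity. *)
Let annulus_sum X F m (o : nat) :
  \sum_(i < m) hausdorff1 (annulus X F (i.*2 + o).+1) <=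
  hausdorff1 (X `&` far F (m.*2 + o)%N).
Proof.
elim: m => [|m IH]; first by rewrite big_ord0 hausdorff1_ge0.
rewrite big_ord_recr/=; apply: le_trans (leeD IH (lexx _)) _.
set k := (m.*2 + o)%N.
apply: le_trans (@hausdorff1_separated _ _ (k.+1%:R^-1 - k.+2%:R^-1)%R _ _ _ _) _.
- by rewrite subr_gt0 ltf_pV2 ?posrE// ltr_nat.
- move=> p q [Xp Fp] [[Xq _] /existsNP[z /not_implyP[Fz /negP]]].
  rewrite -ltNge => qz; have pz := Fp z Fz.
  rewrite lerBlDr; apply: (le_trans pz); apply: (le_trans (ler_enormB_trans q p z)).
  by rewrite lerD2l ltW.
- apply: le_hausdorff1 => p [[Xp Fp]|[[Xp Fp] _]]; split => //.
  by do 2 apply: farS.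
Qed.

(** Adjacent annuli are not separated; summing the two parities apart costs a
    factor 2, and the series still converges. *)
Let annulus_series X F : hausdorff1 X < +oo ->
  \sum_(i <oo) hausdorff1 (annulus X F i.+1) < +oo.
Proof.
move=> Xoo.
have half (o : nat) : \sum_(i <oo) hausdorff1 (annulus X F (i.*2 + o).+1) <= hausdorff1 X.
  apply: lime_le; first by apply: is_cvg_nneseries => *; exact: hausdorff1_ge0.
  apply: nearW => m; rewrite big_mkord; apply: le_trans (annulus_sum _ _ _ _) _.
  by apply: le_hausdorff1 => p [].
apply: (@le_lt_trans _ _ (hausdorff1 X + hausdorff1 X)); last by rewrite lte_add_pinfty.
apply: le_trans (leeD (half 0%N) (half 1%N)).
rewrite -nneseriesD; try by move=> *; exact: hausdorff1_ge0.
apply: lime_le; first by apply: is_cvg_nneseries => *; exact: hausdorff1_ge0.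
apply: nearW => m; rewrite big_mkord.
apply: (@le_trans _ _ (\sum_(i < m) (hausdorff1 (annulus X F (i.*2 + 0).+1) +
    hausdorff1 (annulus X F (i.*2 + 1).+1)))); last first.
  rewrite -(big_mkord xpredT (fun i => hausdorff1 (annulus X F (i.*2 + 0).+1) +
    hausdorff1 (annulus X F (i.*2 + 1).+1))).
  by apply: nneseries_lim_ge => *; rewrite adde_ge0 ?hausdorff1_ge0.
apply: (@le_trans _ _ (\sum_(i < m.*2) hausdorff1 (annulus X F i.+1))).
  rewrite -!(big_mkord xpredT (fun i => hausdorff1 (annulus X F i.+1))).
  apply: lee_sum_nneg_natr => //.
    by move=> *; exact: hausdorff1_ge0.
  by rewrite -addnn leq_addl.
elim: m => [|m IH]; first by rewrite !big_ord0.
rewrite doubleS !big_ord_recr/= addn0 addn1 -addeA; exact: leeD.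
Qed.

(** Caratheodory's criterion.  F and the points far from F are separated, so the
    measure of X splits up to the points of X close to F but outside it.  These
    are covered by a tail of the series of annuli, which tends to 0. *)
Lemma closed_caratheodory (F : set V) : closed F ->
  (@hausdorff1 R n).-cara.-measurable F.
Proof.
move=> Fcl; suff H X : hausdorff1 (X `&` F) + hausdorff1 (X `&` ~` F) <=
    hausdorff1 X by exact: le_caratheodory_measurable.
have [->|] := eqVneq (hausdorff1 X) +oo; first by rewrite leey.
rewrite -ltey => Xoo.
have split_far k : hausdorff1 (X `&` F) + hausdorff1 (X `&` far F k) <= hausdorff1 X.
  apply: le_trans (@hausdorff1_separated _ _ k.+1%:R^-1 _ _ _ _) _ => //.
  - by move=> p q [_ Fp] [_ /(_ p Fp)]; rewrite enormC.
  - by apply: le_hausdorff1 => p [] [].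
have far_cover k : X `&` ~` F `<=` (X `&` far F k.+1) `|`
    \bigcup_(j in ~` `I_k) annulus X F j.+1.
  move=> p [Xp nFp].
  have [j0 pj0] := exists_far Fcl nFp.
  elim: j0 pj0 => [|j0 IH] pj0.
    by left; split => //; elim: k.+1 => // i; exact: farS.
  have [/IH //|npj0] := pselect (far F j0 p).
  have [j0k|kj0] := leqP j0 k.
    left; split => //; rewrite -(subnK j0k); elim: (k - j0)%N => // i.
    by rewrite addSn; exact: farS.
  right; exists j0.-1 => /=; first by apply/negP; rewrite -leqNgt -ltnS prednK// (leq_trans _ kj0).
  by rewrite prednK ?(leq_trans _ kj0)//; split.
have bound k : hausdorff1 (X `&` F) + hausdorff1 (X `&` ~` F) <=
    hausdorff1 X + \sum_(k <= i <oo) hausdorff1 (annulus X F i.+1).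
  apply: le_trans (leeD (split_far k.+1) (lexx _)); rewrite -addeA; apply: leeD => //.
  apply: le_trans (le_hausdorff1 (far_cover k)) _.
  apply: le_trans (outer_measureU2 _ _ _) _; apply: leeD => //.
  exact: (outer_measure_sigma_subadditive_tail _ k (fun j => annulus X F j.+1)).
have : hausdorff1 X + \sum_(k <= i <oo) hausdorff1 (annulus X F i.+1) @[k --> \oo] -->
    hausdorff1 X + 0.
  apply: cvgeD; first by rewrite fin_num_adde_defl.
    exact: cvg_cst.
  by apply: nneseries_tail_cvg; [exact: annulus_series|move=> *; exact: hausdorff1_ge0].
rewrite adde0 => Hlim; apply: cvge_to_ge Hlim _; exact: nearW.
Qed.

Lemma borel_caratheodory : <<s @open V >> `<=` (@hausdorff1 R n).-cara.-measurable.
Proof.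
apply: smallest_sub; first exact: sigma_algebra_measurable.
move=> U oU; rewrite -(setCK U); apply: measurableC.
by apply: closed_caratheodory; rewrite closedC.
Qed.

End caratheodory.

(** * Inner regularity of finite Borel measures *)

Lemma cvgn_exists_lt (R : realType) (f : (\bar R)^nat) (l e : \bar R) :
  (f @ \oo --> l -> l < e -> exists k, f k < e)%E.
Proof.
move=> fl le; have /fl[k _ fk] : nbhs l [set y | y < e]%E.
  by apply: open_nbhs_nbhs; split => //; exact: open_ereal_lt_ereal.
by exists k; apply: fk => /=.
Qed.

Section regularity.
Context {R : realType} {n : nat}.
Local Notation V := 'rV[R]_n.
Local Notation borel := (g_sigma_algebraType (@open V)).
Variable m : {measure set borel -> \bar R}.
Hypothesis m_fin : (m setT < +oo)%E.
Local Open Scope ereal_scope.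

Lemma measurable_open (U : set V) : open U -> measurable (U : set borel).
Proof. exact: sub_sigma_algebra. Qed.

Lemma measurable_closed (F : set V) : closed F -> measurable (F : set borel).
Proof.
move=> cF; rewrite -(setCK F); apply: (@measurableC _ borel).
by apply: measurable_open; exact: closed_openC.
Qed.

Let m_lt (A : set borel) : measurable A -> m A < +oo.
Proof. by move=> mA; apply: le_lt_trans m_fin; apply: le_measure => //; rewrite inE. Qed.

(** Approximation from inside by closed and from outside by open sets is
    inherited by complements and countable unions; this symmetric form is what
    makes an argument on the generated sigma-algebra possible. *)
Let sandwich (A : set V) := forall e : R, (0 < e)%R -> exists F U,
  [/\ closed F, open U, F `<=` A, A `<=` U & m (U `\` F) <= e%:E].

(** The closed sets of points far from the complement of U increase to U. *)
Let sandwich_open U : open U -> sandwich U.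
Proof.
move=> oU e e0.
have mD k : measurable ((U `\` far (~` U) k) : set borel).
  apply: (@measurableD _ borel); first exact: measurable_open.
  by apply: measurable_closed; exact: closed_far.
have : m (U `\` far (~` U) k) @[k --> \oo] --> m (\bigcap_k (U `\` far (~` U) k)).
  apply: nonincreasing_cvg_mu => //.
  - exact: m_lt.
  - by apply: (@bigcap_measurableType _ borel).
  - apply/nonincreasing_seqP => k; apply/subsetPset => p [Up nfp]; split => //.
    by apply: contra_not nfp; exact: farS.
rewrite (_ : \bigcap_k _ = set0) ?measure0; last first.
  rewrite -subset0 => p Up; have cU : closed (~` U) by exact: open_closedC.
  have [k fk] := @exists_far _ _ (~` U) p cU (fun h => h (Up 0%N I).1).
  by have [_] := Up k I; apply.
move=> mk0; have [k mk] : exists k, m (U `\` far (~` U) k) < e%:E.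
  by apply: cvgn_exists_lt mk0 _; rewrite lte_fin.
exists (far (~` U) k), U; split => //; [exact: closed_far| |exact: ltW].
by move=> p /far_disjoint/contrapT.
Qed.

Let sandwich_bigcup (A : (set V)^nat) : (forall i, sandwich (A i)) ->
  sandwich (\bigcup_i A i).
Proof.
move=> swA e e0.
have ei i : (0 < e / 2 / (2 ^ i.+1)%:R)%R by rewrite !divr_gt0// ltr0n expn_gt0.
have /choice[F] := fun i => swA i _ (ei i).
move=> /choice[U FU].
have clF i : closed (F i) by case: (FU i).
have opU i : open (U i) by case: (FU i).
(* An infinite union of the closed sets need not be closed: keep finitely many
   of them, which loses little mass as the measure is finite. *)
pose UU := \bigcup_i U i; pose G k := UU `\` \bigcup_(i < k) F i.
have mF i : measurable (F i : set borel) by exact: measurable_closed.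
have mU i : measurable (U i : set borel) by exact: measurable_open.
have mG k : measurable (G k : set borel).
  apply: (@measurableD _ borel); first exact: (@bigcupT_measurable _ borel).
  exact: (@bigcup_measurable _ borel).
have limG : m (G k) @[k --> \oo] --> m (\bigcap_k G k).
  apply: nonincreasing_cvg_mu => //; first exact: m_lt.
    by apply: (@bigcap_measurableType _ borel).
  apply/nonincreasing_seqP => k; apply/subsetPset => p [Up nfp]; split => //.
  by apply: contra_not nfp => -[i /= ik Fp]; exists i => //=; exact: ltnW.
have mD i : measurable (U i `\` F i : set borel) by exact: (@measurableD _ borel).
have : m (\bigcap_k G k) < e%:E.
  apply: (@le_lt_trans _ _ (e / 2)%:E); last by rewrite lte_fin ltr_pdivrMr// ltr_pMr// ltr1n.
  apply: (@le_trans _ _ (m (\bigcup_i (U i `\` F i)))).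
    apply: le_measure; rewrite ?inE.
    - by apply: (@bigcap_measurableType _ borel).
    - exact: (@bigcupT_measurable _ borel).
    - move=> p Gp; have [i _ Up] := (Gp 0%N I).1; exists i => //; split => //.
      by move=> Fp; apply: (Gp i.+1 I).2; exists i => //=.
  apply: le_trans (measure_sigma_subadditive _ mD _ (@subset_refl _ _)) _.
    exact: (@bigcupT_measurable _ borel).
  have e20 : (0 <= e / 2)%R by rewrite divr_ge0// ltW.
  apply: le_trans (epsilon_trick0 xpredT e20).
  by apply: lee_nneseries => // i _; case: (FU i).
move=> /(cvgn_exists_lt limG)[k mk].
exists (\bigcup_(i < k) F i), UU; split.
- rewrite bigcup_mkord; apply: closed_bigsetU => i _; exact: clF.
- by apply: bigcup_open => i _; exact: opU.
- by move=> p [i _ Fp]; exists i => //; case: (FU i) => _ _ + _ _; apply.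
- by move=> p [i _ Ap]; exists i => //; case: (FU i) => _ _ _ + _; apply.
- exact: ltW.
Qed.

Lemma closed_inner_regular (A : set borel) (e : R) : measurable A -> (0 < e)%R ->
  exists F : set V, [/\ closed F, F `<=` A & m (A `\` F) <= e%:E].
Proof.
move=> mA e0.
have /(_ A mA e e0)[F [U [clF oU FA AU UF]]] : @measurable _ borel `<=` sandwich.
  apply: smallest_sub => [|U]; last exact: sandwich_open.
  split => //.
  - by apply: sandwich_open; exact: open0.
  - move=> B swB r r0; have [F [U [cF oU FB BU UF]]] := swB r r0.
    exists (~` U), (~` F); rewrite setTD; split.
    + exact: open_closedC.
    + exact: closed_openC.
    + exact: subsetC.
    + exact: subsetC.
    + by rewrite setDE setCK setIC -setDE.
exists F; split => //; apply: le_trans UF; apply: le_measure; rewrite ?inE.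
- by apply: (@measurableD _ borel) => //; exact: measurable_closed.
- by apply: (@measurableD _ borel); [exact: measurable_open|exact: measurable_closed].
- exact: setSD.
Qed.

End regularity.

(** * Traces of the Hausdorff measure and images of measures under paths *)

Section borel_measures.
Local Open Scope ereal_scope.

Lemma ge0_integral_mrestr d (T : measurableType d) (R : realType)
    (m : {measure set T -> \bar R}) (D : set T) (mD : measurable D) (f : T -> \bar R) :
  measurable_fun setT f -> (forall x, 0 <= f x) ->
  \int[mrestr m mD]_x f x = \int[m]_(x in D) f x.
Proof.
move=> mf f0; have mDC := measurableC mD.
rewrite -(setUv D) ge0_integral_setU//=; last 2 first.
- by rewrite setUv.
- by rewrite disj_set2E setICr.
have mD0 : mrestr m mD (~` D) = 0 by rewrite /mrestr setICl measure0.
rewrite (null_set_integral mDC (measurable_funTS mf) mD0) adde0.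
by apply: eq_measure_integral => A mA AD /=; rewrite /mrestr; congr (m _); exact: setIidl.
Qed.

Context {R : realType} {n : nat}.
Local Notation V := 'rV[R]_n.
Local Notation borel := (g_sigma_algebraType (@open V)).
Local Notation cara := (caratheodory_type (@hausdorff1 R n)).

(** The Hausdorff measure lives on its Caratheodory sigma-algebra; its traces are
    viewed on the Borel sets, where they can be compared with images of Lebesgue
    measure.  Carrying the measurability proof as an argument lets the measure
    structure be inferred from the term. *)
Definition hausdorff1_trace (D : set borel) (mD : measurable D) (A : set borel) :
  \bar R := hausdorff1 (A `&` D).

Section trace.
Variables (D : set borel) (mD : measurable D).

Let borel_cara (A : set borel) : measurable A -> measurable (A : set cara).
Proof. exact: borel_caratheodory. Qed.

Let trace0 : hausdorff1_trace mD set0 = 0.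
Proof. by rewrite /hausdorff1_trace set0I hausdorff10. Qed.

Let trace_ge0 A : 0 <= hausdorff1_trace mD A.
Proof. exact: hausdorff1_ge0. Qed.

Let trace_sigma_additive : semi_sigma_additive (hausdorff1_trace mD).
Proof.
move=> F mF tF mUF.
exact: (@measure_semi_sigma_additive _ cara _ (mrestr hausdorff1_measure (borel_cara mD)) F
  (fun i => borel_cara (mF i)) tF (borel_cara mUF)).
Qed.

HB.instance Definition _ := isMeasure.Build _ _ _ (hausdorff1_trace mD)
  trace0 trace_ge0 trace_sigma_additive.

(** The trace is the image of the restricted Hausdorff measure under the identity
    from the Caratheodory to the coarser Borel sigma-algebra. *)
Lemma integral_hausdorff1_trace (f : V -> \bar R) :
  measurable_fun setT (f : borel -> \bar R) -> (forall z, 0 <= f z) ->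
  \int[hausdorff1_measure]_(z in D) f z = \int[hausdorff1_trace mD]_z f z.
Proof.
move=> mf f0; pose i : cara -> borel := id.
have mi : measurable_fun setT i by move=> _ A mA; rewrite setTI; exact: borel_cara.
have mfi : measurable_fun setT (f : cara -> \bar R).
  move=> _ A mA; rewrite setTI; apply: borel_cara.
  by have := mf measurableT A mA; rewrite setTI.
transitivity (\int[mrestr hausdorff1_measure (borel_cara mD)]_z (f : cara -> \bar R) z).
  exact: esym (@ge0_integral_mrestr _ cara _ hausdorff1_measure _ (borel_cara mD) f mfi f0).
exact: esym (@ge0_integral_pushforward _ _ cara borel _ i mi
  (mrestr hausdorff1_measure (borel_cara mD)) setT f measurableT mf (fun y _ => f0 y)).
Qed.

End trace.

(** The image under g of the restriction of m to I: the mass that the path g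
    spends in A. *)
Definition path_measure d (T : measurableType d) (m : {measure set T -> \bar R})
  (I : set T) (mI : measurable I) (g : T -> borel) (mg : measurable_fun setT g)
  (A : set borel) : \bar R := m (g @^-1` A `&` I).

Section path_measure.
Context d (T : measurableType d) (m : {measure set T -> \bar R}).
Variables (I : set T) (mI : measurable I).
Variables (g : T -> borel) (mg : measurable_fun setT g).
Local Notation pm := (path_measure m mI mg).

Let mpre A : measurable A -> measurable (g @^-1` A).
Proof. by move=> mA; rewrite -[X in measurable X]setTI; exact: mg. Qed.

Let pm0 : pm set0 = 0.
Proof. by rewrite /path_measure preimage_set0 set0I measure0. Qed.

Let pm_ge0 A : 0 <= pm A.
Proof. exact: measure_ge0. Qed.

Let pm_sigma_additive : semi_sigma_additive pm.
Proof.
move=> F mF tF mUF; rewrite /path_measure preimage_bigcup.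
have h := @measure_semi_sigma_additive _ T _ (mrestr m mI) (fun i => g @^-1` F i)
  (fun i => mpre (mF i)).
apply: h; last by rewrite -preimage_bigcup; exact: mpre.
apply/trivIsetP => /= i j _ _ ij; rewrite -preimage_setI.
by move/trivIsetP : tF => /(_ _ _ _ _ ij) ->//; rewrite preimage_set0.
Qed.

HB.instance Definition _ := isMeasure.Build _ _ _ pm pm0 pm_ge0 pm_sigma_additive.

Lemma integral_path_measure (f : V -> \bar R) :
  measurable_fun setT (f : borel -> \bar R) -> (forall z, 0 <= f z) ->
  \int[pm]_z f z = \int[m]_(t in I) f (g t).
Proof.
move=> mf f0.
rewrite -(ge0_integral_mrestr m mI)//; last first.
  move=> _ A mA; rewrite setTI.
  have mfA : measurable (f @^-1` A : set borel).
    by rewrite -[X in measurable X]setTI; exact: mf.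
  exact: (mpre mfA).
exact: (@ge0_integral_pushforward _ _ _ borel _ g mg (mrestr m mI) setT f measurableT mf
  (fun y _ => f0 y)).
Qed.

End path_measure.
End borel_measures.

(** * The area inequality for paths *)

Section euclidean_lipschitz.
Context {R : realType} {n : nat}.
Local Notation V := 'rV[R]_n.
Local Notation borel := (g_sigma_algebraType (@open V)).

(** Lipschitz for the Euclidean norm, on the whole line: constants, unlike the
    Lipschitz property itself, depend on the norm. *)
Definition elipschitz (L : R) (g : R -> V) :=
  forall s t, enorm (g s - g t) <= L * `|s - t|.

Lemma elipschitz_ge0 L g : elipschitz L g -> 0 <= L.
Proof.
move=> gL; have := le_trans (enorm_ge0 _) (gL 1 0).
by rewrite subr0 normr1 mulr1.
Qed.

Lemma elipschitz_continuous L g : elipschitz L g -> continuous g.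
Proof.
move=> gL; apply: (@lip_continuous _ R^o _ L) => s t.
exact: le_trans (norm_le_enorm _) (gL s t).
Qed.

Lemma measurable_continuous_borel (g : measurableTypeR R -> borel) :
  continuous (g : R -> V) -> measurable_fun setT g.
Proof.
move=> gc; apply: (@measurability _ _ _ borel _ _ (@open V)) => //.
move=> _ [U oU <-]; rewrite setTI; apply: open_measurable.
by move/continuousP : gc; apply.
Qed.

Lemma measurable_elipschitz L (g : R -> V) : elipschitz L g ->
  measurable_fun setT (g : measurableTypeR R -> borel).
Proof. by move=> /elipschitz_continuous; exact: measurable_continuous_borel. Qed.

Lemma closed_path_image (g : R -> V) : continuous g -> closed (g @` `[0, 1]).
Proof.
move=> gc; apply: compact_closed; first exact: norm_hausdorff.
apply: continuous_compact; last exact: segment_compact.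
exact: continuous_subspaceT.
Qed.

End euclidean_lipschitz.

Section area.
Context {R : realType} {n : nat}.
Local Notation V := 'rV[R]_n.
Local Notation borel := (g_sigma_algebraType (@open V)).
Local Open Scope ereal_scope.
Variables (mu : {measure set (measurableTypeR R) -> \bar R}) (L : R) (g : R -> V).
Hypothesis gL : elipschitz L g.
Hypothesis mu_fin : mu `[0%R, 1%R]%classic < +oo.
Hypothesis g_mu : forall s t : R, (0 <= s)%R -> (s <= t)%R -> (t <= 1)%R ->
  (enorm (g t - g s))%:E <= mu `]s, t]%classic.

Let I01 : set R := `[0%R, 1%R]%classic.
(** Half-open cells are disjoint and have exactly the form for which the
    displacement of g is controlled, so that diameters add up to a measure. *)
Let cell k i : set R := `](i%:R / k.+1%:R)%R, (i.+1%:R / k.+1%:R)%R]%classic.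

Let cell_dist k i s t : cell k i s -> cell k i t -> (`|s - t| < k.+1%:R^-1)%R.
Proof.
rewrite /cell /= !in_itv /= => /andP[s1 s2] /andP[t1 t2].
have E : (i.+1%:R / k.+1%:R = i%:R / k.+1%:R + k.+1%:R^-1 :> R)%R.
  by rewrite -[i.+1%:R]natr1 mulrDl mul1r.
move: (k.+1%:R^-1)%R (i%:R / k.+1%:R)%R (i.+1%:R / k.+1%:R)%R E s1 s2 t1 t2.
by move=> b a c E s1 s2 t1 t2; rewrite ltr_norml; apply/andP; split; lra.
Qed.

Let cell01 k i : (i < k.+1)%N -> cell k i `<=` `](0%R : R), 1%R]%classic.
Proof.
move=> ik s; rewrite /cell /= !in_itv /= => /andP[s1 s2].
rewrite (le_lt_trans _ s1) ?divr_ge0//= (le_trans s2)//.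
by rewrite ler_pdivrMr// mul1r ler_nat.
Qed.

Let exists_cell k (s : R) : (0 < s)%R -> (s <= 1)%R -> exists2 i, (i < k.+1)%N & cell k i s.
Proof.
move=> s0 s1.
have ex : exists j, (s <= j%:R / k.+1%:R)%R by exists k.+1; rewrite divff.
case: (ex_minnP ex) => -[|i] si imin.
  by move: si; rewrite mul0r leNgt s0.
have ik : (i < k.+1)%N by apply: imin; rewrite divff.
exists i => //; rewrite /cell /= in_itv /= si andbT ltNge.
by apply/negP => /imin; rewrite ltnn.
Qed.

Let cell_trivIset k : trivIset setT (cell k).
Proof.
apply/trivIsetP => i j _ _; wlog ij : i j / (i < j)%N.
  move=> h; rewrite neq_ltn => /orP[ij|ji]; first by apply: h; rewrite // ltn_eqF.
  by rewrite setIC; apply: h; rewrite // ltn_eqF.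
move=> _; rewrite -subset0 => s; rewrite /cell /= !in_itv /= => -[/andP[_ si] /andP[js _]].
have := lt_le_trans js si; rewrite ltr_pM2r ?invr_gt0//.
by rewrite ltr_nat ltnS leqNgt ij.
Qed.

Let near_pre (F : set V) k : set R := \bigcup_(s in g @^-1` F `&` I01) ball s k.+1%:R^-1.

Let near_pre_open F k : open (near_pre F k).
Proof. by apply: bigcup_open => s _; exact: ball_open. Qed.

(** Cover the part of the image in F by the images of the cells that meet the
    preimage of F.  The diameters of these images sum to at most the mass of
    the union of the cells, all of which are close to the preimage. *)
Let content_le (F : set V) (d : R) k : (L / k.+1%:R <= d)%R -> (0 <= d)%R ->
  hausdorff1_content d (F `&` g @` I01) <= mu (near_pre F k `&` I01).
Proof.
move=> kd d0.
(* The half-open cells miss the time 0, so the remaining indices of the cover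
   carry the point g 0, of diameter 0. *)
pose P i := `[< (i < k.+1)%N /\ exists2 s, cell k i s & F (g s) >].
pose C i := if P i then g @` cell k i else [set g 0%R].
pose J i := if P i then cell k i else set0.
have mJ i : measurable (J i : set (measurableTypeR R)).
  by rewrite /J; case: ifP => _ //; exact: measurable_itv.
have dC i : diam (C i) <= mu (J i).
  rewrite /C /J; case: ifP => [/asboolP[ik _]|_]; last first.
    by rewrite measure0; apply: diam_le => // _ _ -> ->; rewrite subrr enorm0.
  have main s t : cell k i s -> cell k i t -> (s <= t)%R ->
      (enorm (g t - g s))%:E <= mu (cell k i).
    move=> si ti st; have := cell01 ik si; have := cell01 ik ti.
    rewrite /= !in_itv/= => /andP[_ t1] /andP[s0 _].
    apply: le_trans (g_mu (ltW s0) st t1) _.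
    apply: le_measure; rewrite ?inE; [exact: measurable_itv|exact: measurable_itv|].
    move=> u; move: si ti; rewrite /cell /= !in_itv/=.
    move=> /andP[s1 _] /andP[_ t2] /andP[su ut].
    by rewrite (lt_trans s1 su) (le_trans ut t2).
  apply: diam_le => // _ _ [s si <-] [t ti <-].
  by have [st|/ltW ts] := leP t s; [exact: main|rewrite enormC; exact: main].
have Cd i : diam (C i) <= d%:E.
  apply: diam_le => [|p q]; first by rewrite lee_fin.
  rewrite /C lee_fin; case: ifP => _; last by move=> -> ->; rewrite subrr enorm0.
  move=> [s si <-] [t ti <-]; apply: le_trans kd; apply: le_trans (gL s t) _.
  by rewrite ler_wpM2l ?(elipschitz_ge0 gL)// ltW// (cell_dist si ti).
apply: (@le_trans _ _ (\sum_(i <oo) diam (C i))).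
  apply: ereal_inf_lbound; exists C => //; split => // z [Fz [s]].
  rewrite /I01 /= in_itv/= => /andP[s0 s1] sz.
  have [s_eq0|s_neq0] := eqVneq s 0%R.
    exists k.+1 => //; rewrite /C /P; case: ifP => [/asboolP[]|_]; first by rewrite ltnn.
    by rewrite -sz s_eq0.
  have {}s0 : (0 < s)%R by rewrite lt_neqAle eq_sym s_neq0.
  have [i ik si] := exists_cell k s0 s1; exists i => //.
  rewrite /C ifT; first by exists s.
  by apply/asboolP; split => //; exists s; rewrite // sz.
apply: (@le_trans _ _ (\sum_(i <oo) mu (J i))).
  by apply: lee_nneseries => *; [exact: diam_ge0|exact: dC].
have mUJ : measurable (\bigcup_i J i : set (measurableTypeR R)) by exact: bigcupT_measurable.
rewrite -measure_semi_bigcup//; last first.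
  apply/trivIsetP => i j _ _ ij; rewrite /J.
  case: ifP => _; last by rewrite set0I.
  case: ifP => _; last by rewrite setI0.
  by move/trivIsetP : (@cell_trivIset k) => /(_ i j I I ij).
apply: le_measure; rewrite ?inE//.
  apply: measurableI; last exact: measurable_itv.
  exact: open_measurable.
move=> t [i _]; rewrite /J; case: ifP => // /asboolP[ik [s si Fs]] ti.
have in01 u : cell k i u -> I01 u.
  by move=> /(cell01 ik); rewrite /I01 /= !in_itv/= => /andP[/ltW -> ->].
split; last exact: in01.
exists s; first by split => //; exact: in01.
by rewrite /ball /=; exact: cell_dist si ti.
Qed.

(** As the mesh tends to 0 the neighbourhoods of the preimage of F shrink to the
    preimage itself, because F is closed. *)
Lemma hausdorff1_path_closed (F : set V) : closed F ->
  hausdorff1 (F `&` g @` `[0%R, 1%R]%classic) <= mu (g @^-1` F `&` `[0%R, 1%R]).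
Proof.
move=> Fcl; apply: ge_ereal_sup => _ [d /= d0 <-].
have mT k : measurable (near_pre F k `&` I01 : set (measurableTypeR R)).
  by apply: measurableI; [exact: open_measurable|exact: measurable_itv].
have : mu (near_pre F k `&` I01) @[k --> \oo] --> mu (\bigcap_k (near_pre F k `&` I01)).
  apply: nonincreasing_cvg_mu => //.
  - apply: le_lt_trans mu_fin; apply: le_measure; rewrite ?inE//; exact: measurable_itv.
  - by apply: (@bigcap_measurableType _ (measurableTypeR R)) => k _; exact: mT.
  - apply/nonincreasing_seqP => k; apply/subsetPset; apply: setSI.
    move=> t [s Fs st]; exists s => //; apply: le_ball st.
    by rewrite lef_pV2 ?posrE// ler_nat.
have -> : \bigcap_k (near_pre F k `&` I01) = g @^-1` F `&` I01.
  apply/seteqP; split => t; last first.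
    by move=> Ft k _; split; [exists t => //; exact: ballxx|exact: Ft.2].
  move=> tT; split; last by have [] := tT 0%N I.
  have [//|nFt] := pselect (F (g t)).
  have /nbhs_ballP[e /= e0 te] : nbhs t (g @^-1` ~` F).
    apply: (elipschitz_continuous gL); apply: open_nbhs_nbhs.
    by split => //; exact: closed_openC.
  have [[s [Fs _] st] _] := tT (Num.truncn e^-1) I.
  exfalso; apply: (te s _ Fs); apply: ball_sym; apply: le_ball st.
  by rewrite invf_ple ?posrE// ltW// Num.Theory.truncnS_gt.
move=> Tlim; apply: cvge_to_ge Tlim _; near=> k.
apply: content_le; last exact: ltW.
rewrite ler_pdivrMr// -ler_pdivrMl//.
apply: (@le_trans _ _ (k%:R : R)%R); last by rewrite ler_nat.
near: k; exact: nbhs_infty_ger.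
Unshelve. all: by end_near. Qed.

(** The area inequality: if the displacements of g are dominated by the finite
    measure mu, then the image measure of mu dominates H on the image of g.
    Closed sets suffice, because the trace of H on the image is finite and hence
    inner regular. *)
Lemma hausdorff1_path_borel (B : set borel) : measurable B ->
  hausdorff1 (B `&` g @` `[0%R, 1%R]%classic) <= mu (g @^-1` B `&` `[0%R, 1%R]%classic).
Proof.
move=> mB.
have mD : measurable (g @` `[0%R, 1%R]%classic : set borel).
  by apply: measurable_closed; apply: closed_path_image; exact: elipschitz_continuous gL.
have mg A : measurable (A : set borel) -> measurable (g @^-1` A `&` I01 : set (measurableTypeR R)).
  move=> mA; apply: measurableI; last exact: measurable_itv.
  by rewrite -[X in measurable X]setTI; exact: (measurable_elipschitz gL).
have tr_fin : hausdorff1_trace mD setT < +oo.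
  apply: le_lt_trans (hausdorff1_path_closed closedT) _.
  by rewrite preimage_setT setTI.
apply/lee_addgt0Pr => e e0.
have [F [clF FB BF]] := closed_inner_regular tr_fin mB e0.
have mF := measurable_closed clF.
have -> : B `&` g @` `[0%R, 1%R]%classic = (F `&` g @` I01) `|` ((B `\` F) `&` g @` I01).
  apply/seteqP; split => z; last by move=> [[Fz gz]|[[Bz _] gz]]; split => //; exact: FB.
  by move=> [Bz gz]; have [Fz|nFz] := pselect (F z); [left|right].
apply: le_trans (outer_measureU2 _ _ _) _; apply: leeD; last exact: BF.
apply: le_trans (hausdorff1_path_closed clF) _.
by apply: le_measure; rewrite ?inE//; [exact: mg|exact: mg|exact: setSI (preimage_subset FB)].
Qed.

End area.

(** * Absolute continuity and differentiability of Lipschitz functions *)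

Lemma integrable_cst_fin d (T : measurableType d) (R : realType)
    (m : {measure set T -> \bar R}) (A : set T) (k : R) :
  measurable A -> (m A < +oo)%E -> m.-integrable A (EFin \o cst k).
Proof.
move=> mA mAoo; apply/integrableP; split; first exact/measurable_EFinP.
rewrite (eq_integral (cst (`|k|%:E)))// integral_cst//.
by rewrite lte_mul_pinfty// lee_fin.
Qed.

Section lipschitz_density.
Context {R : realType}.
Local Notation mu := (@lebesgue_measure R).
Local Open Scope ereal_scope.

(** Each cover by intervals proving that a set is Lebesgue null proves that it is
    null for the Stieltjes measure, lengths being multiplied by at most K. *)
Lemma stieltjes_null_dominated (phi : cumulative R R) (K : R) : (0 < K)%R ->
  (forall s t, (s <= t)%R -> (phi t - phi s <= K * (t - s))%R) ->
  lebesgue_stieltjes_measure phi `<< mu.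
Proof.
move=> K0 phiK; apply/null_content_dominatesP => A mA muA0.
apply/eqP; rewrite eq_le measure_ge0 andbT; apply/lee_addgt0Pr => e e0.
rewrite add0e.
have eK0 : (0 < e / K)%R by rewrite divr_gt0.
have muA_fin : mu A \is a fin_num by rewrite muA0.
have [_ [F [mF AF] <-]] := lb_ereal_inf_adherent eK0 muA_fin.
rewrite [X in X + _](_ : _ = 0) ?add0e => [FeK|]; last exact: muA0.
apply: (@le_trans _ _ (\sum_(k <oo) wlength phi (F k))).
  by apply: ereal_inf_lbound; exists F.
apply: (@le_trans _ _ (\sum_(k <oo) (K%:E * wlength idfun (F k)))).
  apply: lee_nneseries => [k _ _|k _]; first exact: (wlength_ge0 phi).
  have [->|[[a b] /= ab ->]] := (ocitvP _).1 (mF k); first by rewrite !wlength0 mule0.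
  by rewrite !wlength_itv_bnd ?(ltW ab)// -EFinM lee_fin; exact/phiK/ltW.
rewrite nneseriesZl; last by move=> k _; exact: (wlength_ge0 idfun).
rewrite -lee_pdivlMl// -EFinM mulrC; exact: ltW.
Qed.

Section scalar.
Variables (f : R -> R) (K : R).
Hypotheses (K0 : (0 < K)%R) (fK : forall s t, (`|f s - f t| <= K * `|s - t|)%R).

(** Adding K times the identity makes f nondecreasing, so that it defines a
    Stieltjes measure. *)
Let phi (t : R) : R := (f t + K * t)%R.

Let fK' s t : (s <= t)%R -> (f s - f t <= K * (t - s) /\ f t - f s <= K * (t - s))%R.
Proof.
move=> st; have := fK t s; rewrite [in X in (_ <= X)%R]ger0_norm ?subr_ge0//.
by rewrite ler_norml => /andP[]; rewrite lerNl opprB.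
Qed.

Let phi_nd : nondecreasing phi.
Proof.
move=> s t st; have [h _] := fK' st; rewrite /phi.
by move: h; rewrite mulrBr; lra.
Qed.

Let phi_continuous : continuous phi.
Proof.
apply: (@lip_continuous _ R^o R^o (K + K)) => s t.
rewrite /phi [X in (`|X| <= _)%R](_ : _ = (f s - f t) + K * (s - t))%R; last by ring.
rewrite (le_trans (ler_normD _ _))// mulrDl lerD ?fK//.
by rewrite normrM gtr0_norm.
Qed.

Let phi_rc : right_continuous phi.
Proof. by apply: right_continuousW; exact: phi_continuous. Qed.

Let phi_cumulative : cumulative R R :=
  HB.pack_for (cumulative R R) phi (isCumulative.Build R _ R phi phi_nd phi_rc).

Local Notation nu0 := (lebesgue_stieltjes_measure phi_cumulative).
Let mD : measurable (`]0%R, 1%R]%classic : set (measurableTypeR R)).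
Proof. exact: measurable_itv. Qed.

Let nu0_oc s t : (s <= t)%R -> nu0 `]s, t]%classic = (phi t - phi s)%:E.
Proof.
move=> st; rewrite /lebesgue_stieltjes_measure /measure_extension.
rewrite measurable_mu_extE/=; last exact: is_ocitv.
by rewrite wlength_itv_bnd//= EFinB.
Qed.

Let nu0_fin : nu0 `]0%R, 1%R]%classic < +oo.
Proof. by rewrite nu0_oc// ltry. Qed.

Let nu := mfrestr mD nu0_fin.

Let nu_dom : nu `<< mu.
Proof.
apply/null_content_dominatesP => A mA muA0.
have dom : nu0 `<< mu.
  apply: (@stieltjes_null_dominated _ (K + K)%R); first by rewrite addr_gt0.
  move=> s t st /=; rewrite /phi; have [_ h] := fK' st; move: h; rewrite mulrBr; lra.
have /null_content_dominatesP/(_ _ mA muA0) nuA0 := dom.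
apply/eqP; rewrite eq_le measure_ge0 andbT -[X in _ <= X]nuA0.
by apply: le_measure; rewrite ?inE//; exact: measurableI.
Qed.

(** The Stieltjes measure of [phi] is absolutely continuous; its Radon-Nikodym
    derivative minus K is a density of f, and Lebesgue's differentiation theorem
    identifies it with the derivative of f. *)
Lemma lipschitz_density : exists w : R -> R,
  [/\ mu.-integrable `[0%R, 1%R] (EFin \o w),
      forall s t, (0 <= s)%R -> (s <= t)%R -> (t <= 1)%R ->
        (f t - f s)%:E = \int[mu]_(x in `]s, t]) (w x)%:E &
      {ae mu, forall x, (0 < x < 1)%R -> derivable f x 1 /\ derive1 f x = w x}].
Proof.
have [r [r0 rfin rint rE]] := radon_nikodym_sigma_finite nu_dom.
pose q x := fine (r x).
have qE : EFin \o q = r by apply/funext => x /=; rewrite fineK.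
have qint : mu.-integrable setT (EFin \o q) by rewrite qE.
(* The measure is restricted to ]0, 1], so its distribution function is phi up
   to a constant on [0, 1]. *)
pose F (x : R) := (\int[mu]_(t in `]-oo, x]) q t)%R.
have FE x : (0 <= x)%R -> (x <= 1)%R -> F x = (phi x - phi 0)%R.
  move=> x0 x1; rewrite /F /Rintegral -[X in integral _ _ X]/(EFin \o q) qE -rE//=.
  rewrite /nu /mfrestr /mrestr (_ : _ `&` _ = `]0%R, x]%classic) ?nu0_oc//.
  apply/seteqP; split => t /=; rewrite !in_itv/=; first by move=> [-> /andP[->]].
  by move=> /andP[-> tx]; rewrite tx (le_trans tx).
have ftc : {ae mu, forall x, derivable F x 1 /\ derive1 F x = q x}.
  apply: FTC1Ny; first by move=> y; exact: integrableS qint.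
  by apply: open_integrable_locally; [exact: openT|exact: qint].
exists (fun x => q x - K)%R; split.
- apply: (@integrableB _ _ _ mu _ _ (EFin \o q) (cst K%:E)) => //.
    exact: integrableS qint.
  by apply: integrable_cst_fin => //; rewrite /= lebesgue_measure_itv/= lte_fin ltr01 -EFinB ltry.
- move=> s t s0 st t1.
  have mst : measurable (`]s, t]%classic : set (measurableTypeR R)) by exact: measurable_itv.
  have mst_fin : mu `]s, t]%classic = (t - s)%:E.
    rewrite lebesgue_measure_itv/= lte_fin; have [//|ts] := ltP s t.
    by rewrite (@le_anti _ _ s t) ?subrr// st ts.
  rewrite (@integralB_EFin _ _ _ mu _ q (cst K))//.
  + have -> : \int[mu]_(x in `]s, t]) (cst K x)%:E = (K * (t - s))%:E.
      by rewrite EFinM -mst_fin -integral_cst.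
    rewrite -[X in integral _ _ X]/(EFin \o q) qE -rE//=.
    rewrite /nu /mfrestr /mrestr (_ : _ `&` _ = `]s, t]%classic) ?nu0_oc//.
      by rewrite -EFinB /phi; congr EFin; ring.
    apply/seteqP; split => u /=; rewrite !in_itv/=; first by move=> [].
    by move=> /andP[su ut]; rewrite su ut (le_lt_trans s0)// (le_trans ut).
  + exact: integrableS qint.
  + by apply: integrable_cst_fin => //; rewrite /= mst_fin ltry.
- move: ftc; apply: filterS; first exact: (ae_filter_ringOfSetsType mu).
  move=> x [Fx1 Fx2] /andP[x0 x1].
  have fF : \near x, (F x - K * x + f 0)%R = f x.
    near=> y; have /andP[y0 y1] : (0 < y < 1)%R.
      have : y \in `](0:R)%R, 1%R[ by near: y; apply: near_in_itvoo; rewrite in_itv/= x0.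
      by rewrite in_itv.
    by rewrite FE ?ltW// /phi; ring.
  have Fd : is_derive (x : R) 1%R (F : R -> R) (q x) by apply: DeriveDef => //; rewrite -derive1E.
  have fd : is_derive (x : R) 1%R f (q x - K)%R.
    apply: near_eq_is_derive fF _.
    have := is_deriveD (is_deriveB Fd (is_deriveZ K (is_derive_id (x : R) 1%R))) (is_derive_cst (f 0%R) (x : R) 1%R).
    by move=> /is_derive_eq; apply; rewrite addr0 /GRing.scale/= mulr1.
  by split; [exact: ex_derive|rewrite derive1E derive_val].
Unshelve. all: by end_near. Qed.
End scalar.
End lipschitz_density.

(** * The speed of a Lipschitz path *)

Section speed.
Context {R : realType} {n : nat}.
Local Notation V := 'rV[R]_n.
Local Notation mu := (@lebesgue_measure R).
Local Open Scope ereal_scope.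

Lemma enorm_le_sum (v : V) : (enorm v <= n%:R * \sum_(i < n) `|v ord0 i|)%R.
Proof.
apply: le_trans (enorm_le_norm v) _; rewrite ler_wpM2l//.
rewrite [leLHS]/Num.Def.normr /= mx_normrE; apply/bigmax_leP; split.
  by rewrite sumr_ge0.
by move=> [i j] _ /=; rewrite ord1 (bigD1 j)//= lerDl sumr_ge0.
Qed.

Variables (L : R) (h : R -> V).
Hypothesis hL : elipschitz L h.

(** The coordinates have densities w_i, and w = |(w_i)| is the speed.  With
    u = h t - h s, Cauchy-Schwarz in the form
    |u|^2 = sum_i u_i int w_i <= |u| int w bounds the displacement by the integral
    of w. *)
Lemma elipschitz_speed : exists w : R -> R,
  [/\ forall x, (0 <= w x)%R,
      mu.-integrable `[0%R, 1%R] (EFin \o w),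
      forall s t, (0 <= s)%R -> (s <= t)%R -> (t <= 1)%R ->
        (enorm (h t - h s))%:E <= \int[mu]_(x in `]s, t]) (w x)%:E &
      {ae mu, forall x, (0 < x < 1)%R -> enorm (derive1 h x) = w x}].
Proof.
have L0 := elipschitz_ge0 hL.
have L1 : (0 < L + 1)%R by rewrite ltr_wpDl.
have coordL i s t : (`|h s ord0 i - h t ord0 i| <= (L + 1) * `|s - t|)%R.
  have := coord_le_enorm (h s - h t) i; rewrite !mxE => /le_trans; apply.
  by apply: le_trans (hL s t) _; rewrite ler_wpM2r// lerDl.
have /choice[w wP] := fun i : 'I_n => lipschitz_density L1 (coordL i).
have wint i : mu.-integrable `[0%R, 1%R] (EFin \o w i) by case: (wP i).
have wabs i : mu.-integrable `[0%R, 1%R] (abse \o (EFin \o w i)).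
  by apply: integrable_abse; exact: wint.
pose W x := enorm (\row_i w i x).
have mW : measurable_fun (`[0%R, 1%R]%classic : set (measurableTypeR R)) W.
  rewrite /W /enorm.
  apply: (@measurableT_comp _ _ _ _ _ _ (@Num.sqrt R)).
    by apply: continuous_measurable_fun; exact: sqrt_continuous.
  apply: measurable_sum => i; apply: measurable_funX.
  rewrite (_ : (fun x => _) = w i); last by apply/funext => x; rewrite mxE.
  by apply/measurable_EFinP; exact: measurable_int (wint i).
have Wint : mu.-integrable `[0%R, 1%R] (EFin \o W).
  apply: (@le_integrable _ _ _ mu _ (measurable_itv _) _
    (fun x => n%:R%:E * (\sum_(i < n) `|(w i x)%:E|))).
  - exact/measurable_EFinP.
  - move=> x _ /=; rewrite sumEFin -EFinM !abse_EFin lee_fin [leRHS]ger0_norm ?mulr_ge0 ?sumr_ge0//.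
    rewrite ger0_norm; last exact: enorm_ge0.
    apply: le_trans (enorm_le_sum _) _.
    by rewrite ler_wpM2l//; apply: ler_sum => i _; rewrite mxE.
  - apply: integrableZl; first exact: measurable_itv.
    by apply: integrable_sum => // i _; exact: wabs.
exists W; split => //; first by move=> x; exact: enorm_ge0.
- move=> s t s0 st t1.
  have sub01 : `]s, t]%classic `<=` `[0%R, 1%R]%classic.
    move=> x /=; rewrite !in_itv/= => /andP[sx xt].
    by rewrite (le_trans xt)// (le_trans s0)// ltW.
  have int_st g : mu.-integrable `[0%R, 1%R] g -> mu.-integrable `]s, t] g.
    by apply: integrableS => //; exact: measurable_itv.
  set u := (h t - h s)%R; set e := enorm u.
  have [->|e0] := eqVneq e 0%R.
    by apply: integral_ge0 => x _; rewrite lee_fin enorm_ge0.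
  have {}e0 : (0 < e)%R by rewrite lt_neqAle eq_sym e0 enorm_ge0.
  have -> : \int[mu]_(x in `]s, t]) (W x)%:E =
      (fine (\int[mu]_(x in `]s, t]) (W x)%:E))%:E.
    by rewrite fineK//; apply: integrable_fin_num => //; exact: int_st.
  rewrite lee_fin -(ler_pM2l e0) -lee_fin [leRHS]EFinM fineK; last first.
    by apply: integrable_fin_num => //; exact: int_st.
  rewrite -expr2 sqr_enorm -sumEFin -integralZl//; last exact: int_st.
  rewrite (eq_bigr (fun i => \int[mu]_(x in `]s, t]) ((u ord0 i)%:E * (w i x)%:E))).
    rewrite -integral_sum//; last first.
      by move=> i; apply: integrableZl => //; exact: int_st (wint i).
    apply: le_integral => //.
    + by apply: integrable_sum => // i _; apply: integrableZl => //; exact: int_st (wint i).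
    + by apply: integrableZl => //; exact: int_st.
    + move=> x _; under eq_bigr do rewrite -EFinM.
      rewrite sumEFin -EFinM lee_fin; apply: le_trans (cauchy_schwarz_sum u _).
      by apply: ler_sum => i _; rewrite mxE.
  move=> i _; rewrite integralZl//; last exact: int_st (wint i).
  have [_ /(_ s t s0 st t1) <- _] := wP i.
  by rewrite -EFinM expr2 /u !mxE.
- have : {ae mu, forall x, forall i : 'I_n, (0 < x < 1)%R ->
      derivable (fun y => h y ord0 i) x 1 /\ derive1 (fun y => h y ord0 i) x = w i x}.
    have FF := ae_filter_ringOfSetsType mu; apply: filter_forall.
    by move=> i; case: (wP i).
  apply: filterS; first exact: (ae_filter_ringOfSetsType mu).
  move=> x hx x01; rewrite derive1E derive_mx; last first.
    by apply/derivable_mxP => i j; rewrite ord1; case: (hx j x01).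
  rewrite /W; congr enorm; apply/rowP => i; rewrite !mxE.
  by have [_ <-] := hx i x01; rewrite derive1E.
Qed.

End speed.

(** * Integrals over the image of a path *)

Section integral_lemmas.
Local Open Scope ereal_scope.
Context d (T : measurableType d) (R : realType).
Variable m : {measure set T -> \bar R}.

(** The integral of a nonnegative function is a supremum over simple functions,
    so monotonicity needs no measurability.  This matters because the
    derivative of a path is only known almost everywhere. *)
Lemma ge0_subset_le_integral (D E : set T) (f g : T -> \bar R) :
  D `<=` E -> (forall x, E x -> 0 <= g x) -> (forall x, D x -> 0 <= f x) ->
  (forall x, D x -> f x <= g x) ->
  \int[m]_(x in D) f x <= \int[m]_(x in E) g x.
Proof.
move=> DE g0 f0 fg; rewrite !ge0_integralE//; apply: ge_ereal_sup => _ [k kf <-].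
apply: ereal_sup_ubound; exists k => // x; apply: le_trans (kf x) _; rewrite !patchE.
case: ifPn => xD; first by rewrite mem_set ?fg//; [exact: set_mem|apply: DE; exact: set_mem].
by case: ifPn => // /set_mem; exact: g0.
Qed.

Definition mdensity (w : T -> \bar R) (w0 : forall x, 0 <= w x)
  (mw : measurable_fun setT w) (A : set T) : \bar R := \int[m]_(x in A) w x.

Variable w : T -> \bar R.
Hypotheses (w0 : forall x, 0 <= w x) (mw : measurable_fun setT w).
Local Notation dens := (mdensity w0 mw).

Let mdensity0 : dens set0 = 0.
Proof. exact: integral_set0. Qed.

Let mdensity_ge0 A : 0 <= dens A.
Proof. by apply: integral_ge0 => x _; exact: w0. Qed.

Let mdensity_sigma_additive : semi_sigma_additive dens.
Proof.
move=> F mF tF mUF; rewrite /mdensity ge0_integral_bigcup//; last exact: measurable_funTS.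
apply: is_cvg_nneseries => *; exact: integral_ge0.
Qed.

HB.instance Definition _ := isMeasure.Build _ _ _ dens
  mdensity0 mdensity_ge0 mdensity_sigma_additive.
Import HBNNSimple.

Lemma sintegral_mdensity (k : {nnsfun T >-> R}) :
  sintegral dens k = \int[m]_x ((k x)%:E * w x).
Proof.
have indicM y : measurable_fun setT (fun x => (y * \1_(k @^-1` [set y]) x)%:E).
  by apply: (measurable_comp measurableT) => //; exact: measurable_funM.
transitivity (\int[m]_x (\sum_(y \in range k)
    ((y * \1_(k @^-1` [set y]) x)%:E * w x))); last first.
  apply: eq_integral => x _; rewrite -ge0_mule_fsuml => [|y]; last exact: nnfun_muleindic_ge0.
  by rewrite fsumEFin // -(fimfunE _ x).
rewrite ge0_integral_fsum//; last 2 first.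
  - by move=> y; exact: emeasurable_funM.
  - by move=> y x _; rewrite mule_ge0// nnfun_muleindic_ge0.
rewrite sintegralE; apply: eq_fsbigr => y /[!inE] -[t _ <-].
under [RHS]eq_integral do rewrite EFinM -muleA.
rewrite ge0_integralZl//.
- congr (_ * _); rewrite /= /mdensity [LHS]integral_mkcond; apply: eq_integral => x _.
  by rewrite epatch_indic muleC.
- by apply: emeasurable_funM => //; exact/measurable_EFinP.
- by move=> x _; rewrite mule_ge0// lee_fin.
- by rewrite lee_fin.
Qed.

(** Simple functions below f give simple functions below f w after
    multiplication, whence one inequality for an arbitrary nonnegative f. *)
Lemma ge0_integral_mdensity_le (f : T -> \bar R) : (forall x, 0 <= f x) ->
  \int[dens]_x f x <= \int[m]_x (f x * w x).
Proof.
move=> f0; rewrite [leLHS]ge0_integralTE//; apply: ge_ereal_sup => _ [k /= kf <-].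
rewrite sintegral_mdensity; apply: ge0_subset_le_integral => //.
- by move=> x _; rewrite mule_ge0.
- by move=> x _; rewrite mule_ge0// lee_fin.
- by move=> x _; rewrite lee_wpmul2r.
Qed.

End integral_lemmas.

Section image_integral.
Local Open Scope ereal_scope.
Context {R : realType} {n : nat}.
Local Notation V := 'rV[R]_n.
Local Notation borel := (g_sigma_algebraType (@open V)).

Lemma integral_image_le (mu : {measure set (measurableTypeR R) -> \bar R}) (L : R)
    (g : R -> V) (f : V -> \bar R) :
  elipschitz L g -> mu `[0%R, 1%R]%classic < +oo ->
  (forall s t : R, (0 <= s)%R -> (s <= t)%R -> (t <= 1)%R ->
    (enorm (g t - g s))%:E <= mu `]s, t]%classic) ->
  measurable_fun setT (f : borel -> \bar R) -> (forall z, 0 <= f z) ->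
  \int[hausdorff1_measure]_(z in g @` `[0%R, 1%R]) f z <=
  \int[mu]_(t in `[0%R, 1%R]) f (g t).
Proof.
move=> gL mufin gmu mf f0.
have mD : measurable (g @` `[0%R, 1%R] : set borel).
  by apply: measurable_closed; apply: closed_path_image; exact: elipschitz_continuous gL.
have mI : measurable (`[0%R, 1%R]%classic : set (measurableTypeR R)) by exact: measurable_itv.
rewrite (integral_hausdorff1_trace mD)//.
rewrite -(integral_path_measure mu mI (measurable_elipschitz gL))//.
apply: ge0_le_measure_integral => // A mA.
exact: hausdorff1_path_borel gL mufin gmu _ mA.
Qed.

(** The area inequality for the measure of density |h'|.  The integral on the
    right is over the open interval because the derivative there depends only
    on the values of h in [0, 1]. *)
Lemma integral_image_le_speed (L : R) (h : R -> V) (f : V -> \bar R) :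
  elipschitz L h -> measurable_fun setT (f : borel -> \bar R) -> (forall z, 0 <= f z) ->
  \int[hausdorff1_measure]_(z in h @` `[0%R, 1%R]) f z <=
  \int[lebesgue_measure]_(t in `]0%R, 1%R[) (f (h t) * (enorm (derive1 h t))%:E).
Proof.
move=> hL mf f0; have [W [W0 Wint hW [N [mN N0 hN]]]] := elipschitz_speed hL.
have mI : measurable (`[0%R, 1%R]%classic : set (measurableTypeR R)) by exact: measurable_itv.
pose w := (EFin \o W) \_ (`[0%R, 1%R]%classic : set (measurableTypeR R)).
have w0 x : 0 <= w x.
  by rewrite /w patchE; case: ifPn => // _; rewrite lee_fin.
have mw : measurable_fun setT w.
  by apply: (measurable_restrictT _ mI).1; exact: measurable_int Wint.
pose dens := mdensity lebesgue_measure w0 mw.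
have densI (A : set (measurableTypeR R)) : A `<=` `[0%R, 1%R]%classic ->
    dens A = \int[lebesgue_measure]_(x in A) (W x)%:E.
  by move=> AI; apply: eq_integral => x /set_mem/AI xI; rewrite /w patchE mem_set.
have mfh : measurable_fun setT (f \o h : measurableTypeR R -> \bar R).
  move=> _ A mA; rewrite setTI.
  have mfA : measurable (f @^-1` A : set borel).
    by rewrite -[X in measurable X]setTI; exact: mf.
  by have := measurable_elipschitz hL measurableT mfA; rewrite setTI.
apply: le_trans (@integral_image_le dens L h f hL _ _ mf f0) _.
- rewrite [X in X < _]densI//.
  have /integrableP[_] := Wint; apply: le_lt_trans.
  by apply: ge0_subset_le_integral => // x _; rewrite ?lee_fin ?W0 ?normr_ge0// ler_norm.
- move=> s t s0 st t1; apply: le_trans (hW s t s0 st t1) _.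
  rewrite [leRHS]densI// => x /=; rewrite !in_itv/= => /andP[sx xt].
  by rewrite (le_trans xt)// (le_trans s0)// ltW.
apply: (@le_trans _ _ (\int[dens]_x f (h x))); first exact: ge0_subset_le_integral.
apply: le_trans (ge0_integral_mdensity_le _ _ _ _) _ => //.
have F0 x : 0 <= f (h x) * w x by exact: mule_ge0.
have mF : measurable_fun setT (fun x => f (h x) * w x) by exact: emeasurable_funM.
rewrite (_ : \int[_]_x _ = \int[lebesgue_measure]_(x in `[0%R, 1%R]) (f (h x) * w x)); last first.
  rewrite [RHS]integral_mkcond; apply: eq_integral => x _; rewrite patchE.
  by case: ifPn => // xI; rewrite /w patchE (negbTE xI) mule0.
(* The exceptional set of differentiability together with the two endpoints. *)
pose N1 : set (measurableTypeR R) := N `|` ([set 0%R] `|` [set 1%R]).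
have mN1 : measurable N1 by apply: measurableU => //; apply: measurableU; exact: measurable_set1.
have N10 : lebesgue_measure N1 = 0.
  apply: null_set_setU => //; first by apply: measurableU; exact: measurable_set1.
  by apply: null_set_setU; [exact: measurable_set1|exact: measurable_set1| |];
    exact: lebesgue_measure_set1.
rewrite (ge0_negligible_integral mN1)//; last exact: measurable_funTS.
have in01 x : (`[0%R, 1%R] `\` N1) x -> (0 < x < 1)%R.
  move=> [xI xN1]; move: xI; rewrite /= in_itv/= => /andP[x0 x1].
  rewrite !lt_neqAle x0 x1 !andbT; apply/andP; split; apply/eqP => e; apply: xN1; right.
    by left; rewrite e.
  by right; rewrite -e.
apply: ge0_subset_le_integral.
- by move=> x /in01; rewrite /= in_itv.
- by move=> x _; rewrite mule_ge0// lee_fin enorm_ge0.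
- by move=> x _; exact: F0.
move=> x xIN; have x01 := in01 x xIN; have [xI xN1] := xIN.
rewrite /w patchE mem_set//=.
suff -> : enorm (derive1 h x) = W x by [].
apply: contrapT => hx; apply: xN1; left; apply: hN => /= /(_ x01).
exact: hx.
Qed.

End image_integral.

(** * Distance and Hausdorff measure *)

Section distance_content.
Context {R : realType} {n : nat}.
Local Notation V := 'rV[R]_n.
Local Notation mu := (@lebesgue_measure R).
Local Open Scope ereal_scope.

(** An interval of length diam F containing the distances from p0 to the points
    of F; empty for empty F, where the infimum is meaningless. *)
Let shadow (p0 : V) (F : set V) : set R :=
  let m := inf [set enorm (p - p0) | p in F] in
  if F == set0 then set0 else `[m, (m + fine (diam F))%R]%classic.

(** The distance to g s is a 1-Lipschitz function; along g it takes all values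
    between 0 and |g t - g s|.  So the shadows of a cover of the image cover that
    interval, and their lengths are at most the diameters. *)
Lemma enorm_le_hausdorff1 (L : R) (g : R -> V) (s t : R) : elipschitz L g ->
  (s <= t)%R -> (enorm (g t - g s))%:E <= hausdorff1 (g @` `[s, t]).
Proof.
move=> gL st; apply: le_trans (hausdorff1_content_le _ (@ltr01 R)).
apply: le_ereal_inf_tmp => _ [F [F1 AF] <-].
set c := enorm (g t - g s).
have c0 : (0 <= c)%R by exact: enorm_ge0.
have Ffin i : diam (F i) \is a fin_num.
  by rewrite ge0_fin_numE ?diam_ge0// (le_lt_trans (F1 i))// ltry.
pose G i := shadow (g s) (F i).
have mG i : measurable (G i : set (measurableTypeR R)).
  by rewrite /G /shadow; case: ifP => // _; exact: measurable_itv.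
have dF p q i : F i p -> F i q ->
    (enorm (p - g s) - fine (diam (F i)) <= enorm (q - g s))%R.
  move=> Fp Fq; rewrite lerBlDr.
  apply: le_trans (ler_enormB_trans q p (g s)) _; rewrite addrC lerD2l.
  by rewrite -lee_fin fineK//; exact: enorm_le_diam.
have inG p i : F i p -> G i (enorm (p - g s)).
  move=> Fp; rewrite /G /shadow; case: eqP => [F0|_]; first by move: Fp; rewrite F0.
  rewrite /= in_itv/=; apply/andP; split.
    have lbE : has_lbound [set enorm (p - g s) | p in F i].
      by exists 0%R => _ [q _ <-]; exact: enorm_ge0.
    by apply: ge_inf lbE _ _; exists p.
  rewrite -lerBlDr; apply: lb_le_inf; first by exists (enorm (p - g s)); exists p.
  by move=> _ [q Fq <-]; exact: dF.
have -> : c%:E = mu `[0%R, c]%classic.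
  rewrite lebesgue_measure_itv/= lte_fin; have [//|c0'] := ltP 0%R c.
    by rewrite -EFinB subr0.
  by congr EFin; apply: le_anti; rewrite c0 c0'.
apply: (@le_trans _ _ (\sum_(i <oo) mu (G i))); last first.
  apply: lee_nneseries => [i _ _|i _]; first exact: measure_ge0.
  rewrite /G /shadow; case: ifP => _; first by rewrite measure0 diam_ge0.
  rewrite lebesgue_measure_itv/= lte_fin; case: ifP => _; last exact: diam_ge0.
  by rewrite -EFinB addrAC subrr add0r fineK.
have mc : measurable (`[0%R, c]%classic : set (measurableTypeR R)) by exact: measurable_itv.
apply: (measure_sigma_subadditive mu mG mc).
move=> v /=; rewrite in_itv/= => /andP[v0 vc].
have gc : continuous (fun u => enorm (g u - g s)).
  apply: (@lip_continuous _ R^o R^o L) => u u'; apply: le_trans (gL u u').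
  by apply: le_trans (ler_dist_enorm _ _) _; rewrite opprB addrA subrK.
have [] := @IVT _ (fun u => enorm (g u - g s)) s t v st.
- exact: continuous_subspaceT.
- rewrite subrr enorm0 -/c; apply/andP; split.
    by rewrite ge_min v0.
  by rewrite le_max vc orbT.
move=> u ust <-; have [i _ Fi] := AF (g u) (ex_intro2 _ _ u ust erefl).
by exists i => //; exact: inG.
Qed.

End distance_content.

(** * Compactness of families of curves *)

Section curves.
Context {R : realType} {n : nat}.
Local Notation V := 'rV[R]_n.

(** The projection of the line onto [0, 1]; composing with it turns a path on
    [0, 1] into a Lipschitz map on the line with the same constant. *)
Definition clamp (t : R) : R := Num.max 0 (Num.min 1 t).

Lemma clamp01 t : `[0%R, 1%R]%classic (clamp t).
Proof. by rewrite /clamp /= in_itv/= le_max lexx/= ge_max ler01 ge_min lexx. Qed.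

Lemma clamp_id t : `[0%R, 1%R]%classic t -> clamp t = t.
Proof. by rewrite /= in_itv/= => /andP[t0 t1]; rewrite /clamp min_r// max_r. Qed.

Lemma clamp0 : clamp 0 = 0.
Proof. by apply: clamp_id; rewrite /= in_itv/= lexx ler01. Qed.

Lemma clamp1 : clamp 1 = 1.
Proof. by apply: clamp_id; rewrite /= in_itv/= lexx ler01. Qed.

Lemma clampK t : clamp (clamp t) = clamp t.
Proof. by apply: clamp_id; exact: clamp01. Qed.

Lemma clamp_lip s t : `|clamp s - clamp t| <= `|s - t|.
Proof.
wlog st : s t / s <= t.
  move=> h; have [st|/ltW ts] := leP s t; first exact: h.
  by rewrite distrC [leRHS]distrC; exact: h.
rewrite [leRHS]ler0_norm ?subr_le0// opprB /clamp.
rewrite ler_norml; apply/andP.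
case: (leP 1 s) => s1; case: (leP 1 t) => t1; rewrite ?(max_r ler01);
  case: (leP 0 s) => s0; case: (leP 0 t) => t0; split; lra.
Qed.

(** Curves are constant outside [0, 1], so that Lipschitz bounds and pointwise
    limits can be stated on the whole line. *)
Definition curve (E : set V) (x y : V) (L : R) (g : R -> V) :=
  [/\ elipschitz L g, forall t, g t = g (clamp t), forall t, E (g t), g 0 = x & g 1 = y].

Lemma curve_clamp E x y L g : elipschitz L g -> (forall t, `[0%R, 1%R]%classic t -> E (g t)) ->
  g 0 = x -> g 1 = y -> curve E x y L (g \o clamp).
Proof.
move=> gL gE g0 g1; split.
- move=> s t; apply: le_trans (gL _ _) _.
  by rewrite ler_wpM2l ?clamp_lip// (elipschitz_ge0 gL).
- by move=> t /=; rewrite clampK.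
- by move=> t; apply: gE; exact: clamp01.
- by rewrite /= clamp_id//= in_itv/= lexx ler01.
- by rewrite /= clamp_id//= in_itv/= lexx ler01.
Qed.

Lemma cvg_subsequence (u : nat -> R) M : (forall k, 0 <= u k <= M) ->
  exists (s : nat -> nat) (l : R), (forall k, (k <= s k)%N) /\ u (s k) @[k --> \oo] --> l.
Proof.
move=> uM.
have [l [_ lu]] : `[0, M]%classic `&` cluster (u @ \oo) !=set0.
  apply: (@segment_compact R 0 M).
  by exists 0%N => // k _ /=; rewrite in_itv/= uM.
have ex k : exists j, (k <= j)%N /\ `|u j - l| < k.+1%:R^-1.
  have uk : (u @ \oo) [set u j | j in [set j | (k <= j)%N]].
    by exists k => // j kj; exists j.
  have lk : nbhs l (ball l k.+1%:R^-1) by apply: nbhsx_ballx; rewrite invr_gt0.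
  have [_ [[j kj <-] ul]] := lu _ _ uk lk.
  by exists j; split => //; rewrite distrC.
have /choice[s sP] := ex; exists s, l; split=> [k|]; first by case: (sP k).
apply/cvgrPdist_lt => e e0; near=> k; rewrite distrC.
apply: lt_trans (sP k).2 _.
near: k; exact: near_infty_natSinv_lt (PosNum e0).
Unshelve. all: by end_near. Qed.

Lemma nbhs_eball (p : V) (e : R) : 0 < e -> nbhs p [set q | enorm (q - p) < e].
Proof.
move=> e0; have := @enormB_continuous R n p p.
move/cvgrPdist_lt => /(_ e e0); apply: filterS => q /=.
by rewrite subrr enorm0 sub0r normrN ger0_norm ?enorm_ge0.
Qed.

(** The Arzela-Ascoli argument in two steps.  Tychonoff's theorem gives a cluster
    point g of the sequence for pointwise convergence.  A member of index k >= m
    that is close to g on the grid of mesh 1/(m+1) is close to g on [0, 1] by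
    equicontinuity, so choosing one for each m gives a convergent sequence. *)
Lemma equilipschitz_subsequence (M : R) (f : nat -> R -> V) (C : set V) :
  compact C -> (forall k, elipschitz M (f k)) -> (forall k t, C (f k t)) ->
  exists (s : nat -> nat) (g : R -> V), [/\ forall k, (k <= s k)%N, elipschitz M g &
    forall t, `[0%R, 1%R]%classic t -> f (s k) t @[k --> \oo] --> g t].
Proof.
move=> Cc fM fC.
have [g [_ gf]] : [set g : prod_topology (fun _ : R => V) | forall t, C (g t)] `&`
    @cluster (prod_topology (fun _ : R => V)) (f @ \oo) !=set0.
  apply: (@tychonoff R (fun=> V) (fun=> C)) => //.
  by exists 0%N => // k _ t; exact: fC.
have approx (I : finType) (p : I -> R) (e : R) m : 0 < e ->
    exists k, (m <= k)%N /\ forall i, enorm (f k (p i) - g (p i)) < e.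
  move=> e0.
  have fm : (f @ \oo) [set f k | k in [set k | (m <= k)%N]].
    by exists m => // k mk; exists k.
  have gp : nbhs (g : prod_topology (fun _ : R => V))
      [set h | forall i : I, enorm (h (p i) - g (p i)) < e].
    have FF : Filter (nbhs (g : prod_topology (fun _ : R => V))) by exact: nbhs_filter.
    refine (@filter_forall _ I (fun i => [set h : prod_topology (fun _ : R => V) |
      enorm (h (p i) - g (p i)) < e]) _ FF _) => i.
    exact: (@proj_continuous R (fun=> V) (p i) g _ (nbhs_eball (g (p i)) e0)).
  by have [_ [[k mk <-] hk]] := gf _ _ fm gp; exists k.
have gM : elipschitz M g.
  move=> s t; apply/ler_addgt0Pr => e e0.
  have e20 : 0 < e / 2 by rewrite divr_gt0.
  have [k [_ hk]] := approx bool (fun b => if b then s else t) (e / 2) 0%N e20.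
  have := hk true; have := hk false => /= kt ks.
  have := fM k s t; have := ler_enormB_trans (f k s) (g s) (g t).
  have := ler_enormB_trans (f k t) (f k s) (g t).
  rewrite (enormC (g s) (f k s)); lra.
have grid m : exists k, (m <= k)%N /\
    forall i : 'I_m.+2, enorm (f k (i%:R / m.+1%:R) - g (i%:R / m.+1%:R)) < m.+1%:R^-1.
  by apply: approx; rewrite invr_gt0.
have /choice[s sP] := grid.
exists s, g; split => //; first by move=> k; case: (sP k).
move=> t /=; rewrite in_itv/= => /andP[t0 t1].
apply/cvgrPdist_lt => e e0.
have M1 : 0 < M + M + 1 by rewrite ltr_wpDl// addr_ge0// (elipschitz_ge0 gM).
have e1 : 0 < (M + M + 1)^-1 * e by rewrite mulr_gt0// invr_gt0.
near=> m.
have [i ti] : exists i : 'I_m.+2, `|t - i%:R / m.+1%:R| <= m.+1%:R^-1.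
  have tm0 : 0 <= t * m.+1%:R by rewrite mulr_ge0.
  have im : (Num.truncn (t * m.+1%:R) < m.+2)%N.
    rewrite -(ltr_nat R); apply: (@le_lt_trans _ _ (t * m.+1%:R)).
      by rewrite Num.Theory.truncn_le.
    by apply: (@le_lt_trans _ _ m.+1%:R); rewrite ?ltr_nat// ler_piMl.
  exists (Ordinal im) => /=.
  have /andP[i1 i2] := Num.Theory.truncn_itv tm0.
  rewrite ger0_norm ?subr_ge0 ?ler_pdivrMr// lerBlDr -[X in X + _]mul1r -mulrDl.
  by rewrite ler_pdivlMr// nat1r ltW.
apply: le_lt_trans (norm_le_enorm _) _.
set p := i%:R / m.+1%:R in ti.
apply: (@le_lt_trans _ _ ((M + M + 1) * m.+1%:R^-1)).
  have fgp := (sP m).2 i; rewrite -/p in fgp.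
  have := fM (s m) p t; have := gM t p.
  have := ler_enormB_trans (g p) (g t) (f (s m) t).
  have := ler_enormB_trans (f (s m) p) (g p) (f (s m) t).
  rewrite (enormC (g p) (f (s m) p)) (distrC p t).
  have M0 := elipschitz_ge0 gM.
  have := ler_wpM2l M0 ti.
  rewrite !mulrDl mul1r; move: (m.+1%:R^-1) fgp => r fgp.
  move: (M * r) (M * `|t - p|) => Mr Mq; lra.
rewrite -ltr_pdivlMl//; near: m.
exact: near_infty_natSinv_lt (PosNum e1).
Unshelve. all: by end_near. Qed.

End curves.

(** * Shortest curves in a compact set *)

Section shortest_curves.
Context {R : realType} {n : nat}.
Local Notation V := 'rV[R]_n.
Local Notation borel := (g_sigma_algebraType (@open V)).
Variables (E : set V) (x y : V).
Hypothesis cptE : compact E.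

Let closedE : closed E.
Proof. by apply: compact_closed cptE; exact: norm_hausdorff. Qed.

(** The Lipschitz constant of the limit is the limit of the constants, not just a
    common bound: this is what keeps masses from being overestimated. *)
Lemma curve_subsequence (M l : R) (L : nat -> R) (f : nat -> R -> V) :
  (forall k, curve E x y (L k) (f k)) -> (forall k, L k <= M) -> L @ \oo --> l ->
  exists (s : nat -> nat) (g : R -> V), [/\ forall k, (k <= s k)%N, curve E x y l g &
    forall t, f (s k) t @[k --> \oo] --> g t].
Proof.
move=> fL LM Ll.
have fM k : elipschitz M (f k).
  by move=> s t; case: (fL k) => + _ _ _ _ => /(_ s t)/le_trans; apply; rewrite ler_wpM2r.
have fE k t : E (f k t) by case: (fL k).
have [s [g [sk gM fg]]] := equilipschitz_subsequence cptE fM fE.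
have soo : s k @[k --> \oo] --> \oo.
  by move=> A [N _ NA]; exists N => // k /= Nk; apply: NA => /=; exact: leq_trans (sk k).
exists s, (g \o clamp); rewrite /=.
have fgc t : f (s k) t @[k --> \oo] --> g (clamp t).
  rewrite (_ : (fun k => _) = (fun k => f (s k) (clamp t))).
    by apply: fg; exact: clamp01.
  by apply/funext => k; case: (fL (s k)) => _ + _ _ _; apply.
split => //; split.
- move=> u v /=.
  have lim1 : enorm (f (s k) u - f (s k) v) @[k --> \oo] --> enorm (g (clamp u) - g (clamp v)).
    exact: (cvg_comp _ _ (cvgB (fgc u) (fgc v)) (@enorm_continuous _ _ _)).
  have lim2 : L (s k) * `|u - v| @[k --> \oo] --> l * `|u - v|.
    by apply: cvgM; [exact: cvg_comp soo Ll|exact: cvg_cst].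
  apply: ler_cvg_to lim1 lim2 _; apply: nearW => k.
  by case: (fL (s k)).
- by move=> t /=; rewrite clampK.
- by move=> t /=; apply: (@closed_cvg _ _ _ _ (fun k => f (s k) t) E closedE _ _ (fgc t)); apply: nearW => k; exact: fE.
- apply: (@cvg_unique _ (@norm_hausdorff _ V) _ _ _ _ (fgc 0)).
  apply: cvg_near_cst; apply: nearW => k; by case: (fL (s k)).
- apply: (@cvg_unique _ (@norm_hausdorff _ V) _ _ _ _ (fgc 1)).
  apply: cvg_near_cst; apply: nearW => k; by case: (fL (s k)).
Qed.

(** Length is expressed by the Lipschitz constant: the infimum of the lengths of
    curves is the infimum of their constants, by parametrisation with constant
    speed. *)
Definition shortest (l : R) (psi : R -> V) :=
  curve E x y l psi /\ forall L g, curve E x y L g -> l <= L.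

Lemma exists_shortest L0 g0 : curve E x y L0 g0 -> exists l psi, shortest l psi.
Proof.
move=> g0c; pose S := [set L | exists g, curve E x y L g].
have S0 : S !=set0 by exists L0, g0.
have lbS : has_lbound S by exists 0 => L [g []] /elipschitz_ge0.
have /choice[L LP] : forall k, exists L, S L /\ L < inf S + k.+1%:R^-1.
  move=> k; have k0 : (0 < k.+1%:R^-1 :> R) by rewrite invr_gt0.
  by have [L SL Lk] := inf_adherent k0 (conj S0 lbS); exists L.
have /choice[f fP] := fun k => (LP k).1.
have Llim : L @ \oo --> inf S.
  apply/cvgrPdist_lt => e e0; near=> k.
  rewrite distrC ger0_norm ?subr_ge0; last by apply: ge_inf => //; case: (LP k).
  rewrite ltrBlDl; apply: lt_trans (LP k).2 _; rewrite ltrD2l.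
  near: k; exact: near_infty_natSinv_lt (PosNum e0).
have LM k : L k <= inf S + 1.
  apply: le_trans (ltW (LP k).2) _; rewrite lerD2l invf_le1// ler1n//.
have [s [g [_ gc _]]] := curve_subsequence fP LM Llim.
exists (inf S), g; split => // L1 g1 g1c.
by apply: ge_inf => //; exists g1.
Unshelve. all: by end_near. Qed.

(** If psi s = psi t with s < t, skip ]s, t[ and run the rest of psi on the whole
    of [0, 1]: the constant is multiplied by 1 - (t - s) < 1. *)
Lemma shortest_injective l psi : x <> y -> shortest l psi -> set_inj `[0%R, 1%R] psi.
Proof.
move=> xy [[pl pclamp pE p0 p1] lmin].
have main s t : 0 <= s -> s < t -> t <= 1 -> psi s <> psi t.
  move=> s0 st t1 pst.
  set d := t - s; set k := 1 - d.
  have d0 : 0 < d by rewrite subr_gt0.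
  have k0 : 0 <= k by rewrite /k /d; lra.
  have l0 : 0 <= l := elipschitz_ge0 pl.
  (* The time change: slope k throughout, with a jump from s to t. *)
pose th u := if k * u <= s then k * u else k * u + d.
  have thlip u v : u <= v -> enorm (psi (th u) - psi (th v)) <= k * l * `|u - v|.
    move=> uv; have kuv : k * u <= k * v by rewrite ler_wpM2l.
    have kuvE : `|k * u - k * v| = k * `|u - v| by rewrite -mulrBr normrM ger0_norm.
    rewrite [k * l]mulrC -mulrA -kuvE /th.
    case: (leP (k * u) s) => us; case: (leP (k * v) s) => vs.
    - exact: pl.
    - apply: le_trans (ler_enormB_trans (psi s) _ _) _.
      apply: le_trans (lerD (pl _ _) (lexx _)) _; rewrite [in X in X + _ <= _]ler0_norm ?subr_le0//.
      rewrite pst; apply: le_trans (lerD (lexx _) (pl _ _)) _.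
      rewrite [in X in _ + X <= _]ler0_norm; last by rewrite /d; lra.
      rewrite ler0_norm ?subr_le0// -mulrDr ler_wpM2l// /d; lra.
    - by move: (le_trans kuv vs); rewrite leNgt us.
    - by apply: le_trans (pl _ _) _; rewrite ler_wpM2l// opprD addrACA subrr addr0.
  have etal : elipschitz (k * l) (psi \o th).
    move=> u v; have [uv|/ltW vu] := leP u v; first exact: thlip.
    by rewrite enormC distrC; exact: thlip.
  have th0 : th 0 = 0 by rewrite /th mulr0 s0.
  have th1 : psi (th 1) = y.
    rewrite /th mulr1; case: ifPn => ks; last by rewrite /k subrK p1.
    have -> : k = s by apply: le_anti; rewrite ks/= /k /d; lra.
    by rewrite pst (_ : t = 1) ?p1//; apply: le_anti; rewrite t1/=; move: ks; rewrite /k /d; lra.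
  have := lmin _ _ (curve_clamp etal (fun u _ => pE (th u)) (etrans (congr1 psi th0) p0) th1).
  have l_gt0 : 0 < l.
    have := pl 0 1; rewrite p0 p1 sub0r normrN normr1 mulr1; apply: lt_le_trans.
    rewrite lt_neqAle enorm_ge0 andbT eq_sym; apply/eqP => /enorm_eq0/eqP.
    by rewrite subr_eq0 => /eqP.
  by rewrite ler_pMl// leNgt /k; have : 1 - d < 1 by [lra]; move=> ->.
move=> s t; rewrite !inE /= !in_itv/= => /andP[s0 s1] /andP[t0 t1] pst.
by case: (ltgtP s t) => // [st|ts]; exfalso;
  [exact: (main s t)|exact: (main t s)].
Qed.

Local Notation H := (@hausdorff1 R n).
Local Open Scope ereal_scope.

(** The area inequality for L times Lebesgue measure. *)
Lemma curve_hausdorff1_borel L g (B : set V) : curve E x y L g ->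
  measurable (B : set borel) ->
  H (B `&` g @` `[0%R, 1%R]) <= L%:E * lebesgue_measure (g @^-1` B `&` `[0%R, 1%R]).
Proof.
move=> [gL _ _ _ _] mB; have L0 := elipschitz_ge0 gL.
pose m : {measure set (measurableTypeR R) -> \bar R} :=
  mscale (NngNum L0) (@lebesgue_measure R).
have mE (A : set (measurableTypeR R)) : m A = L%:E * lebesgue_measure A by [].
rewrite -mE; apply: (@hausdorff1_path_borel _ _ m L) => //.
- by rewrite mE lebesgue_measure_itv/= lte_fin ltr01 -EFinB -EFinM ltry.
- move=> s t s0 st t1; rewrite mE lebesgue_measure_itv/= lte_fin.
  have := gL t s; case: ltP => [st'|ts].
    by rewrite ger0_norm ?subr_ge0// -EFinB -EFinM lee_fin.
  have -> : t = s by apply: le_anti; rewrite st ts.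
  by rewrite subrr enorm0 mule0.
Qed.

(** Let v t be the measure of the part of the image covered up to time t.  It
    dominates the displacements of psi ([enorm_le_hausdorff1]), so psi
    reparametrised by v / v 1 is a curve with constant v 1; minimality gives
    l <= v 1, and the converse is the area inequality. *)
Lemma shortest_hausdorff1 l psi : shortest l psi -> H (psi @` `[0%R, 1%R]) = l%:E.
Proof.
move=> [pc lmin]; have [pl pclamp pE p0 p1] := pc.
have l0 := elipschitz_ge0 pl.
have mI (s t : R) : measurable (psi @` `[s, t] : set borel).
  apply: measurable_closed; apply: compact_closed; first exact: norm_hausdorff.
  apply: continuous_compact; last exact: segment_compact.
  by apply: continuous_subspaceT; exact: elipschitz_continuous pl.
apply/eqP; rewrite eq_le; apply/andP; split.
  have := curve_hausdorff1_borel pc (measurableT : measurable (setT : set borel)).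
  rewrite setTI preimage_setT setTI => /le_trans; apply.
  by rewrite lebesgue_measure_itv/= lte_fin ltr01 -EFinB -EFinM lee_fin subr0 mulr1.
have [xy|xy] := pselect (x = y).
  apply: le_trans (hausdorff1_ge0 _); rewrite lee_fin.
  apply: (lmin 0%R (cst x)); split => //=.
  - by move=> s t; rewrite subrr enorm0 mul0r.
  - by rewrite -p0.
have inj := shortest_injective xy (conj pc lmin).
have in01 (u : R) : (0 <= u)%R -> (u <= 1)%R -> u \in `[0%R, 1%R]%classic.
  by move=> u0 u1; rewrite inE /= in_itv/= u0.
have Hseg (s t : R) : (0 <= s)%R -> (s <= t)%R -> (t <= 1)%R ->
    H (psi @` `[s, t]) <= (l * (t - s))%:E.
  move=> s0 st t1; have := curve_hausdorff1_borel pc (mI s t).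
  have -> : psi @` `[s, t] `&` psi @` `[0%R, 1%R] = psi @` `[s, t].
    apply/setIidl => _ [u /= + <-]; rewrite in_itv/= => /andP[su ut].
    by exists u => //=; rewrite in_itv/= (le_trans s0 su) (le_trans ut t1).
  have -> : psi @^-1` (psi @` `[s, t]) `&` `[0%R, 1%R] = `[s, t]%classic.
    apply/seteqP; split => u /=; last first.
      rewrite !in_itv/= => /andP[su ut]; split; last by rewrite (le_trans s0 su) (le_trans ut t1).
      by exists u => //; rewrite in_itv/= su.
    move=> [[u' + uu'] u01]; rewrite !in_itv/= => /andP[su' u't].
    rewrite -(inj u' u) ?su' ?u't//; last by rewrite inE.
    by apply: in01; [exact: le_trans s0 su'|exact: le_trans u't t1].
  move=> /le_trans; apply; rewrite lebesgue_measure_itv/= lte_fin.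
  case: ltP => [st'|ts]; first by rewrite -EFinB -EFinM.
  by rewrite mule0 lee_fin mulr_ge0// subr_ge0.
pose v (t : R) := fine (H (psi @` `[0%R, t])).
have Hfin (t : R) : (0 <= t)%R -> (t <= 1)%R -> H (psi @` `[0%R, t]) \is a fin_num.
  move=> t0 t1; rewrite ge0_fin_numE ?hausdorff1_ge0//.
  by apply: le_lt_trans (Hseg 0%R t _ _ _) _; rewrite ?ltry.
have vdiff (s t : R) : (0 <= s)%R -> (s <= t)%R -> (t <= 1)%R ->
    (enorm (psi t - psi s) <= v t - v s <= l * (t - s))%R.
  move=> s0 st t1; have s1 := le_trans st t1; have t0 := le_trans s0 st.
  have Hadd : H (psi @` `[0%R, t]) = H (psi @` `[0%R, s]) + H (psi @` `]s, t]).
    rewrite [LHS](borel_caratheodory (mI 0%R s)); congr (H _ + H _).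
      apply/setIidr => _ [u /= + <-]; rewrite in_itv/= => /andP[u0 us].
      by exists u => //=; rewrite in_itv/= u0 (le_trans us).
    apply/seteqP; split => z.
      move=> [[u /= + <-] nu]; rewrite in_itv/= => /andP[u0 ut].
      exists u => //=; rewrite in_itv/= ut andbT ltNge; apply/negP => us.
      by apply: nu; exists u => //=; rewrite in_itv/= u0.
    move=> [u /= + <-]; rewrite in_itv/= => /andP[su ut]; split.
      by exists u => //=; rewrite in_itv/= ut (le_trans s0 (ltW su)).
    move=> [u' /= + uu']; rewrite in_itv/= => /andP[u'0 u's].
    have u'u : u' = u.
      by apply: inj => //; apply: in01; rewrite ?(le_trans u's)// ?(le_trans ut)// (le_trans s0)// ltW.
    by move: su; rewrite -u'u ltNge u's.
  have Hst : H (psi @` `]s, t]) \is a fin_num.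
    have := Hfin t t0 t1; rewrite Hadd ge0_fin_numE ?adde_ge0 ?hausdorff1_ge0//.
    rewrite ge0_fin_numE ?hausdorff1_ge0//; apply: le_lt_trans.
    by rewrite leeDr// hausdorff1_ge0.
  rewrite /v Hadd fineD// ?Hfin// addrAC subrr add0r -!lee_fin fineK//.
  apply/andP; split; last first.
    apply: le_trans (Hseg s t s0 st t1); apply: le_hausdorff1; apply: image_subset.
    by move=> u /=; rewrite !in_itv/= => /andP[/ltW -> ->].
  apply: le_trans (enorm_le_hausdorff1 pl st) _.
  apply: (@le_trans _ _ (H ([set psi s] `|` psi @` `]s, t]))).
    apply: le_hausdorff1 => _ [u /= + <-]; rewrite in_itv/= => /andP[su ut].
    have [<-|us] := eqVneq s u; first by left.
    by right; exists u => //=; rewrite in_itv/= ut andbT lt_neqAle us.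
  apply: le_trans (outer_measureU2 _ _ _) _; rewrite -[leRHS]add0e; apply: leeD => //.
  by rewrite le_eqVlt; apply/orP; left; apply/eqP; exact: hausdorff1_set1.
have v0 : v 0%R = 0%R.
  have := Hseg 0%R 0%R (lexx _) (lexx _) ler01; rewrite subrr mulr0 => H0.
  by rewrite /v (le_anti (introT andP (conj H0 (hausdorff1_ge0 _)))).
have v1 : H (psi @` `[0%R, 1%R]) = (v 1%R)%:E by rewrite fineK// Hfin.
have v1_ge0 : (0 <= v 1%R)%R by rewrite fine_ge0// hausdorff1_ge0.
rewrite v1 lee_fin.
have vc : continuous (v \o clamp).
  apply: (@lip_continuous _ R^o R^o l) => s t /=.
  apply: (@le_trans _ _ (l * `|clamp s - clamp t|)%R); last by rewrite ler_wpM2l ?clamp_lip.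
  wlog st : s t / (clamp s <= clamp t)%R.
    move=> h; have [st|/ltW ts] := leP (clamp s) (clamp t); first exact: h.
    by rewrite distrC [(`|clamp s - _|)%R]distrC; exact: h.
  have := clamp01 s; have := clamp01 t; rewrite /= !in_itv/= => /andP[_ t1] /andP[s0 _].
  have /andP[vst1 vst2] := vdiff _ _ s0 st t1.
  rewrite ler0_norm; last by rewrite subr_le0 -subr_ge0 (le_trans (enorm_ge0 _) vst1).
  by rewrite ler0_norm ?subr_le0// !opprB.
(* The inverse of v, chosen by the intermediate value theorem. *)
have /choice[th thP] : forall u, exists t, (0 <= t <= 1)%R /\ v t = (clamp u * v 1)%R.
  move=> u; have := clamp01 u; rewrite /= in_itv/= => /andP[u0 u1].
  have [] := @IVT _ (v \o clamp) 0 1 (clamp u * v 1)%R ler01.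
  - exact: continuous_subspaceT.
  - rewrite /= clamp0 clamp1 v0 min_l// max_r//.
    by rewrite mulr_ge0//= ler_piMl.
  by move=> t t01 /= vt; exists (clamp t); split => //; have := clamp01 t; rewrite /= in_itv.
apply: (lmin _ ((psi \o th) \o clamp)); apply: curve_clamp => /=.
- move=> s t /=; apply: (@le_trans _ _ `|v (th s) - v (th t)|%R).
    have [/andP[s0 s1] _] := thP s; have [/andP[t0 t1] _] := thP t.
    have [st|/ltW ts] := leP (th s) (th t).
      by have /andP[+ _] := vdiff _ _ s0 st t1; rewrite enormC distrC => /le_trans; apply; exact: ler_norm.
    by have /andP[+ _] := vdiff _ _ t0 ts s1; move=> /le_trans; apply; exact: ler_norm.
  rewrite (thP s).2 (thP t).2 -mulrBl normrM mulrC (ger0_norm v1_ge0).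
  by rewrite ler_wpM2l// clamp_lip.
- by move=> t _; exact: pE.
- have [/andP[t0 t1]] := thP 0%R; rewrite clamp0 mul0r.
  move=> vt; have /andP[+ _] := vdiff _ _ (lexx _) t0 t1; rewrite vt v0 subrr.
  move=> h; apply/eqP; rewrite -p0 -subr_eq0; apply/eqP/enorm_eq0/le_anti.
  by rewrite h enorm_ge0.
- have [/andP[t0 t1]] := thP 1%R; rewrite clamp1 mul1r.
  move=> vt; have /andP[+ _] := vdiff _ _ t0 t1 (lexx _); rewrite vt subrr enormC.
  move=> h; apply/eqP; rewrite -p1 -subr_eq0; apply/eqP/enorm_eq0/le_anti.
  by rewrite h enorm_ge0.
Qed.

End shortest_curves.

(** * Integrals and superlevel sets *)

Section staircase.
Context {R : realType}.
Local Open Scope ereal_scope.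

(** The largest multiple of d among 0, ..., J d below r (0 if none is), written
    as a sum over the levels below r: its integral then involves only the
    measures of superlevel sets. *)
Definition staircase (d : R) (J : nat) (r : \bar R) : R :=
  (\sum_(j < J) d * (`[< ((j.+1%:R * d)%:E < r)%E >])%:R)%R.

Lemma staircase_ge0 d J r : (0 <= d)%R -> (0 <= staircase d J r)%R.
Proof. by move=> d0; apply: sumr_ge0 => j _; rewrite mulr_ge0. Qed.

Lemma staircase_recr d J r : staircase d J.+1 r =
  (staircase d J r + d * (`[< ((J.+1%:R * d)%:E < r)%E >])%:R)%R.
Proof. by rewrite /staircase big_ord_recr. Qed.

Lemma staircase_full d J r : (0 <= d)%R -> (J%:R * d)%:E < r ->
  staircase d J r = (J%:R * d)%R.
Proof.
move=> d0; elim: J => [|J IH] Jr; first by rewrite /staircase big_ord0 mul0r.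
rewrite staircase_recr asboolT// mulr1 IH; last first.
  by apply: le_lt_trans Jr; rewrite lee_fin ler_wpM2r// ler_nat.
by rewrite -[J.+1%:R]natr1 mulrDl mul1r.
Qed.

Lemma staircase_le d J r : (0 <= d)%R -> 0 <= r -> (staircase d J r)%:E <= r.
Proof.
move=> d0 r0; elim: J => [|J IH]; first by rewrite /staircase big_ord0.
have [Jr|Jr] := boolP `[< ((J.+1%:R * d)%:E < r)%E >].
  by move/asboolP : Jr => Jr; rewrite (staircase_full d0 Jr) ltW.
by rewrite staircase_recr (negbTE Jr) mulr0 addr0.
Qed.

Lemma staircase_ge d J r (q : R) : (0 <= d)%R -> q%:E <= r -> (q <= J%:R * d)%R ->
  (q - d <= staircase d J r)%R.
Proof.
move=> d0 qr; elim: J => [|J IH] qJ.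
  by rewrite /staircase big_ord0 subr_le0 (le_trans qJ)// mul0r.
have [qJ'|Jq] := leP q (J%:R * d)%R.
  by apply: le_trans (IH qJ') _; rewrite staircase_recr lerDl mulr_ge0.
rewrite staircase_recr staircase_full//; last by rewrite (lt_le_trans _ qr)// lte_fin.
rewrite lerBlDr (le_trans qJ)// -[J.+1%:R]natr1 mulrDl mul1r lerD2r.
by rewrite lerDl mulr_ge0.
Qed.

(** Steps 1/(N+1) up to the height N+1: finer and taller as N grows. *)
Definition stair (N : nat) := staircase N.+1%:R^-1 (N.+1 * N.+1).

Lemma stair_cvg (r : \bar R) : 0 <= r -> (stair N r)%:E @[N --> \oo] --> r.
Proof.
move=> r0.
have stepN N : ((N.+1 * N.+1)%:R * N.+1%:R^-1 = N.+1%:R :> R)%R.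
  by rewrite natrM mulfK.
have d0 N : (0 <= N.+1%:R^-1 :> R)%R by [].
case: r r0 => [r| |//] r0.
- apply: cvg_EFin; first exact: nearW.
  apply/cvgrPdist_le => e e0; near=> N.
  have rN : (r <= N.+1%:R)%R.
    by apply: (@le_trans _ _ (N%:R)%R); [near: N; exact: nbhs_infty_ger|rewrite ler_nat].
  have h1 := staircase_le (N.+1 * N.+1) (d0 N) r0.
  have h2 : (r - N.+1%:R^-1 <= stair N r%:E)%R by apply: staircase_ge; rewrite ?stepN.
  have h3 : (N.+1%:R^-1 <= e)%R by apply: ltW; near: N; exact: (near_infty_natSinv_lt (PosNum e0)).
  rewrite lee_fin in h1; rewrite ger0_norm ?subr_ge0//= lerBlDr -lerBlDl.
  by apply: le_trans h2; rewrite lerD2l lerN2.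
- apply/cvgeyPge => A; near=> N; rewrite lee_fin.
  rewrite /stair staircase_full ?stepN ?ltry//.
  by apply: (@le_trans _ _ (N%:R)%R); [near: N; exact: nbhs_infty_ger|rewrite ler_nat].
Unshelve. all: by end_near. Qed.

End staircase.

Section layers.
Context d (T : measurableType d) (R : realType).
Local Open Scope ereal_scope.
Implicit Types m : {measure set T -> \bar R}.
Variable F : T -> \bar R.
Hypotheses (mF : measurable_fun setT F) (F0 : forall z, 0 <= F z).

Let above (r : R) : set T := [set z | r%:E < F z].

Let mabove r : measurable (above r).
Proof.
rewrite /above -[X in measurable X]setTI.
by apply: emeasurable_fun_o_infty.
Qed.

Let stairE N z : (stair N (F z))%:E =
  \sum_(j < N.+1 * N.+1) (N.+1%:R^-1)%:E * (\1_(above (j.+1%:R * N.+1%:R^-1)) z)%:E.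
Proof.
rewrite /stair /staircase -sumEFin; apply: eq_bigr => j _.
by rewrite EFinM indicE; congr (_ * (_%:R)%:E).
Qed.

Lemma integral_stair m N : \int[m]_z (stair N (F z))%:E =
  \sum_(j < N.+1 * N.+1) (N.+1%:R^-1)%:E * m (above (j.+1%:R * N.+1%:R^-1)).
Proof.
under eq_integral do rewrite stairE.
rewrite ge0_integral_sum//.
- apply: eq_bigr => j _; rewrite ge0_integralZl//.
    by rewrite integral_indic// setIT.
  exact/measurable_EFinP.
- by move=> j; apply: emeasurable_funM => //; exact/measurable_EFinP.
Qed.

(** Each staircase below F has finitely many levels, so its integrals pass to the
    limit by semicontinuity on the superlevel sets; Fatou's lemma recovers F. *)
Lemma le_integral_layers m (mk : nat -> {measure set T -> \bar R}) (c : R) :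
  (forall r e : R, (0 <= r)%R -> (0 < e)%R ->
    \forall k \near \oo, m [set z | r%:E < F z] <= mk k [set z | r%:E < F z] + e%:E) ->
  (forall k, \int[mk k]_z F z <= (c + k.+1%:R^-1)%:E) ->
  \int[m]_z F z <= c%:E.
Proof.
move=> mmk mkc.
have mstair N : measurable_fun setT (fun z => (stair N (F z))%:E).
  under eq_fun do rewrite stairE; apply: emeasurable_sum => j.
  by apply: emeasurable_funM => //; exact/measurable_EFinP.
have stair0 N z : 0 <= (stair N (F z))%:E by rewrite lee_fin staircase_ge0.
have stair_c N : \int[m]_z (stair N (F z))%:E <= c%:E.
  apply/lee_addgt0Pr => e e0.
  have e20 : (0 < e / 2)%R by rewrite divr_gt0.
  (* There are (N+1)^2 levels of weight 1/(N+1), so an error h on each of them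
   adds up to e / 2. *)
pose h := (e / 2 / N.+1%:R)%R; have h0 : (0 < h)%R by rewrite divr_gt0.
  have : \forall k \near \oo, (forall j : 'I_(N.+1 * N.+1),
      m (above (j.+1%:R * N.+1%:R^-1)) <= mk k (above (j.+1%:R * N.+1%:R^-1)) + h%:E) /\
      (k.+1%:R^-1 <= e / 2)%R.
    near=> k; split; last by apply: ltW; near: k; exact: (near_infty_natSinv_lt (PosNum e20)).
    near: k; apply: filter_forall => j; apply: mmk => //; exact: mulr_ge0.
  move=> /filter_ex[k [mj ke]].
  rewrite integral_stair.
  apply: (@le_trans _ _ (\sum_(j < N.+1 * N.+1) ((N.+1%:R^-1)%:E *
      mk k (above (j.+1%:R * N.+1%:R^-1)) + (N.+1%:R^-1 * h)%:E))).
    apply: lee_sum => j _; rewrite EFinM -ge0_muleDr ?lee_fin ?(ltW h0)//.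
    by rewrite lee_wpmul2l ?lee_fin.
  rewrite big_split/= -integral_stair sumEFin sumr_const card_ord.
  rewrite (_ : _ *+ _ = e / 2)%R; last first.
    rewrite /h -[LHS]mulr_natl natrM; have : (N.+1%:R : R) != 0%R by rewrite pnatr_eq0.
    by move: (N.+1%:R : R)%R => u u0; field.
  rewrite -EFinD [X in _ <= X%:E](_ : _ = c + e / 2 + e / 2)%R; last by field.
  rewrite EFinD; apply: leeD => //.
  apply: (@le_trans _ _ (\int[mk k]_z F z)).
    by apply: ge0_le_integral => // z _; exact: staircase_le.
  by apply: le_trans (mkc k) _; rewrite lee_fin lerD2l.
rewrite (eq_integral (fun z => limn_einf (fun N => (stair N (F z))%:E))); last first.
  by move=> z _; have [-> _] := cvg_limn_einf_sup (stair_cvg (F0 z)).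
apply: le_trans (fatou _ _ _ _) _ => //.
rewrite limn_einf_lim; apply: lime_le; first exact: is_cvg_einfs.
apply: nearW => N; apply: le_trans (stair_c N); apply: ereal_inf_lbound.
by exists N => //=.
Unshelve. all: by end_near. Qed.

End layers.

(** * Measurability of the extended cost *)

Section extension.
Context {R : realType} {n : nat}.
Local Notation V := 'rV[R]_n.
Local Notation borel := (g_sigma_algebraType (@open V)).
Local Open Scope ereal_scope.
Variables (S : set V) (a : \bar R) (b : V -> R).
Hypotheses (S_borel : <<s @open V >> S) (a_ge0 : 0 <= a).
Hypotheses (b_ge0 : forall z, S z -> (0 <= b z)%R).
Hypothesis (b_lsc : lower_semicontinuous (fun z : subspace S => (b z)%:E)).

Lemma extend_ge0 z : 0 <= extend S a b z.
Proof. by rewrite /extend; case: ifPn => // /set_mem; rewrite lee_fin; exact: b_ge0. Qed.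

(** By lower semicontinuity the points of S where b exceeds r are cut out of S by
    an open set; outside S the extension is constant. *)
Lemma measurable_extend : measurable_fun setT (extend S a b : borel -> \bar R).
Proof.
apply: (measurability _ (ErealGenOInfty.measurableE R)).
move=> _ [_ [r ->] <-]; rewrite setTI.
(* The largest open set inside which the points of S have b > r. *)
pose U := interior [set z | S z -> (r < b z)%R].
have mU : measurable (U : set borel) by apply: measurable_open; exact: open_interior.
rewrite (_ : _ @^-1` _ = (S `&` U) `|` (if `[< r%:E < a >] then ~` S else set0)).
  apply: (@measurableU _ borel); first exact: (@measurableI _ borel).
  by case: ifP => // _; exact: (@measurableC _ borel).
apply/seteqP; split => z /=; rewrite in_itv/= andbT /extend.
  case: ifPn => [/set_mem Sz|/negP nSz] rz.
    left; split => //; have [A] := @b_lsc z r rz.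
    rewrite /nbhs/= -nbhs_subspace_in// => zA Ab; apply: filterS zA.
    by move=> w /Ab /=; rewrite lte_fin.
  right; rewrite ifT; first by move=> Sz; apply: nSz; exact: mem_set.
  exact/asboolP.
case=> [[Sz /interior_subset/(_ Sz)]|]; first by rewrite mem_set.
by case: ifP => // /asboolP ra nSz; rewrite memNset.
Qed.

Lemma sublevelE l : sublevel S b l = S `&` ~` [set z | l%:E < extend S a b z].
Proof.
apply/seteqP; split => z /= [Sz].
  by move=> bl; split => //; rewrite /extend mem_set// lte_fin; apply/negP; rewrite -leNgt.
by move=> bl; split => //; rewrite leNgt; apply/negP => lb; apply: bl; rewrite /extend mem_set.
Qed.

Lemma measurable_superlevel l : measurable ([set z | l%:E < extend S a b z] : set borel).
Proof.
rewrite -[X in measurable X]setTI.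
apply: (@emeasurable_fun_o_infty _ borel) => //; exact: measurable_extend.
Qed.

Lemma measurable_sublevel l : measurable (sublevel S b l : set borel).
Proof.
rewrite sublevelE; apply: (@measurableI _ borel) => //.
by apply: (@measurableC _ borel); exact: measurable_superlevel.
Qed.

End extension.

(** * Curves of constant speed *)

Lemma measureUC d (T : measurableType d) (R : realType)
    (m : {measure set T -> \bar R}) (A : set T) : measurable A ->
  (m A + m (~` A) = m setT)%E.
Proof.
by move=> mA; rewrite -measureU ?setUv//; [exact: measurableC|rewrite setICr].
Qed.

Section paths.
Context {R : realType} {n : nat}.
Local Notation V := 'rV[R]_n.
Local Notation borel := (g_sigma_algebraType (@open V)).
Local Notation H := (@hausdorff1 R n).
Local Notation mu := (@lebesgue_measure R).
Local Notation I01 := (`[0%R : R, 1%R]%classic).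
Implicit Types (x y : V) (E : set V).

(** Where g is not differentiable its formal derivative is the default value 0 of
    a divergent limit. *)
Lemma enorm_derive1_le (l : R) (g : R -> V) t : elipschitz l g -> enorm (derive1 g t) <= l.
Proof.
move=> gl; rewrite /derive1.
set q := fun h : R => _; have [cq|ncq] := pselect (cvg (q @ 0^')); last first.
  rewrite (dvgP ncq) (_ : point = 0) ?enorm0 ?(elipschitz_ge0 gl)//.
  by apply/rowP => i; rewrite !mxE.
have qlim : enorm (q h) @[h --> 0^'] --> enorm (lim (q @ 0^')).
  exact: (cvg_comp _ _ cq (@enorm_continuous R n _)).
have lcst : (fun _ : R => l) h @[h --> 0^'] --> l by exact: cvg_cst.
apply: (ler_cvg_to qlim lcst); near=> h.
have h0 : h != 0 by near: h; exact: nbhs_dnbhs_neq.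
rewrite /q enormZ normfV mulrC ler_pdivrMr ?normr_gt0//.
by apply: le_trans (gl _ _) _; rewrite addrK.
Unshelve. all: by end_near. Qed.

(** The dimension enters the constant as the maximum norm is replaced by the
    Euclidean one. *)
Lemma lip_paths_curve x y g : lip_paths x y g ->
  exists L, curve cube x y L (g \o clamp).
Proof.
move=> [[M [_ HM]] gcube g0 g1]; pose K := Num.max (M + 1) 0.
have MK : M < K by rewrite lt_max ltrDl ltr01.
have K0 : 0 <= K by rewrite le_max lexx orbT.
exists (n%:R * K); split => /=.
- move=> s t /=; apply: le_trans (enorm_le_norm _) _; rewrite -mulrA ler_wpM2l//.
  have := HM K MK (clamp s, clamp t) (conj (clamp01 s) (clamp01 t)) => /= /le_trans; apply.
  by rewrite ler_wpM2l// clamp_lip.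
- by move=> t; rewrite clampK.
- by move=> t; apply: gcube; exists (clamp t) => //; exact: clamp01.
- by rewrite clamp0.
- by rewrite clamp1.
Qed.

Lemma curve_lip_paths E x y L g : E `<=` cube -> curve E x y L g -> lip_paths x y g.
Proof.
move=> Ec [gL _ gE g0 g1]; split => //; last first.
  by move=> _ [t _ <-]; apply: Ec.
have PF : ProperFilter (globally (I01 `*` I01)).
  by apply: (@globally_properfilter _ _ (0, 0)); split; rewrite /= in_itv/= lexx ler01.
apply: (@klipschitzW _ _ _ L) => -[s t] _ /=.
exact: le_trans (norm_le_enorm _) (gL s t).
Qed.

Lemma path_image_clamp (g : R -> V) : (g \o clamp) @` I01 = g @` I01.
Proof.
apply/seteqP; split => [_ [t t01 <-]|_ [t t01 <-]]; exists t => //=; rewrite clamp_id//.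
Qed.

Local Open Scope ereal_scope.

Lemma measurable_I01 : measurable (I01 : set (measurableTypeR R)).
Proof. exact: measurable_itv. Qed.

Local Notation mI := measurable_I01.

Lemma lebesgue_measure_I01 : mu I01 = 1.
Proof. by rewrite lebesgue_measure_itv/= lte_fin ltr01 -EFinB subr0. Qed.

Section curve.
Variables (E : set V) (x y : V) (L : R) (g : R -> V) (f : V -> \bar R).
Hypothesis gc : curve E x y L g.
Hypotheses (mf : measurable_fun setT (f : borel -> \bar R)) (f0 : forall z, 0 <= f z).

Let gL : elipschitz L g. Proof. by case: gc. Qed.
Let L0 := elipschitz_ge0 gL.
Let mg : measurable_fun setT (g : measurableTypeR R -> borel).
Proof. exact: measurable_elipschitz gL. Qed.
Let mD : measurable (g @` I01 : set borel).
Proof.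
by apply: measurable_closed; apply: closed_path_image; exact: elipschitz_continuous gL.
Qed.

Lemma measurable_along_curve : measurable_fun setT (f \o g : measurableTypeR R -> \bar R).
Proof.
move=> _ A mA; rewrite setTI.
have mfA : measurable (f @^-1` A : set borel).
  by rewrite -[X in measurable X]setTI; exact: mf.
by have := mg measurableT mfA; rewrite setTI.
Qed.

(** The mass spent by g in a set when it is run at speed L. *)
Definition curve_measure : {measure set borel -> \bar R} :=
  path_measure (mscale (NngNum L0) mu) mI mg.

Lemma curve_measureE (A : set borel) : curve_measure A = L%:E * mu (g @^-1` A `&` I01).
Proof. by []. Qed.

Lemma integral_curve_measure :
  \int[curve_measure]_z f z = L%:E * \int[mu]_(t in I01) f (g t).
Proof.
rewrite integral_path_measure//.
apply: (ge0_integral_mscale _ _ (NngNum L0)) => //; exact: measurable_funTS measurable_along_curve.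
Qed.

Lemma curve_integral_le :
  \int[hausdorff1_measure]_(z in g @` I01) f z <= L%:E * \int[mu]_(t in I01) f (g t).
Proof.
rewrite -integral_curve_measure (integral_hausdorff1_trace mD)//.
apply: ge0_le_measure_integral => // A mA.
exact: (curve_hausdorff1_borel gc mA).
Qed.

Hypothesis gH : H (g @` I01) = L%:E.

(** H on the image is dominated by the curve measure, and both have total mass L,
    so they agree. *)
Lemma constant_speed_preimage (B : set V) : measurable (B : set borel) ->
  H (B `&` g @` I01) = L%:E * mu (g @^-1` B `&` I01).
Proof.
move=> mB; apply/eqP; rewrite eq_le; apply/andP; split; first exact: (curve_hausdorff1_borel gc mB).
have mCB : measurable (~` B : set borel) by exact: measurableC.
have leC := curve_hausdorff1_borel gc mCB.
have eqL : L%:E * mu (g @^-1` B `&` I01) + L%:E * mu (g @^-1` (~` B) `&` I01) = L%:E.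
  have := measureUC curve_measure mB.
  by rewrite !curve_measureE preimage_setT setTI => ->; rewrite lebesgue_measure_I01 mule1.
have eqH : H (B `&` g @` I01) + H (~` B `&` g @` I01) = L%:E.
  have := measureUC (hausdorff1_trace mD) mB.
  by rewrite /= /hausdorff1_trace setTI gH.
have Hfin : H (~` B `&` g @` I01) \is a fin_num.
  rewrite ge0_fin_numE ?hausdorff1_ge0//; apply: le_lt_trans (ltry L).
  by rewrite -gH; apply: le_hausdorff1; exact: subIsetr.
by rewrite -(leeD2rE _ _ Hfin) eqH -[leRHS]eqL; exact: leeD.
Qed.

Lemma constant_speed_integral :
  \int[hausdorff1_measure]_(z in g @` I01) f z = L%:E * \int[mu]_(t in I01) f (g t).
Proof.
rewrite -integral_curve_measure (integral_hausdorff1_trace mD)//.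
apply: eq_measure_integral => A mA _; exact: (constant_speed_preimage mA).
Qed.

End curve.

(** The path is first made constant outside [0, 1]; this changes neither its image
    nor its derivative in the open interval. *)
Lemma lip_path_integral_le x y g (f : V -> \bar R) : lip_paths x y g ->
  measurable_fun setT (f : borel -> \bar R) -> (forall z, 0 <= f z) ->
  \int[hausdorff1_measure]_(z in g @` I01) f z <=
  \int[mu]_(t in I01) (f (g t) * (enorm (derive1 g t))%:E).
Proof.
move=> gxy mf f0; have [L [gL _ _ _ _]] := lip_paths_curve gxy.
rewrite -path_image_clamp; apply: le_trans (integral_image_le_speed gL mf f0) _.
apply: ge0_subset_le_integral.
- exact: subset_itv_oo_cc.
- by move=> t _; rewrite mule_ge0// lee_fin enorm_ge0.
- by move=> t _; rewrite mule_ge0// lee_fin enorm_ge0.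
move=> t t01; have t01' : I01 t by exact: subset_itv_oo_cc t01.
suff -> : derive1 (g \o clamp) t = derive1 g t by rewrite /= clamp_id.
rewrite !derive1E; apply: near_eq_derive; near=> s.
suff s01 : I01 s by rewrite /= clamp_id.
apply: subset_itv_oo_cc; near: s.
apply: open_nbhs_nbhs; split => //; exact: interval_open.
Unshelve. all: by end_near. Qed.

Lemma exists_arc E x y L g : compact E -> curve E x y L g ->
  exists l psi, [/\ curve E x y l psi, x <> y -> set_inj I01 psi & H (psi @` I01) = l%:E].
Proof.
move=> cE gc; have [l [psi sh]] := exists_shortest cE gc.
exists l, psi; split; [by case: sh|move=> xy; exact: shortest_injective xy sh|].
exact: shortest_hausdorff1 sh.
Qed.

End paths.

(** * Existence and length of minimizers *)

Section urban.
Context {R : realType} {n : nat}.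
Local Notation V := 'rV[R]_n.
Local Notation borel := (g_sigma_algebraType (@open V)).
Local Notation H := (@hausdorff1 R n).
Local Notation mu := (@lebesgue_measure R).
Local Notation I01 := (`[0%R : R, 1%R]%classic).
Local Open Scope ereal_scope.

Lemma compact_cube : compact (@cube R n).
Proof.
rewrite (_ : cube = [set v : V | forall i, `[(- 1 : R)%R, 1%R]%classic (v ord0 i)]).
  by apply: (@rV_compact R n (fun=> `[(- 1 : R)%R, 1%R]%classic)) => i; exact: segment_compact.
by apply/seteqP; split => v vc i; have := vc i; rewrite /= in_itv.
Qed.

Variables (S : set V) (a : \bar R) (b : V -> R).
Hypotheses (S_borel : <<s @open V >> S) (a_ge0 : 0 <= a).
Hypotheses (b_ge0 : forall z, S z -> (0 <= b z)%R).
Hypothesis (b_lsc : lower_semicontinuous (fun z : subspace S => (b z)%:E)).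
Hypothesis (b_le_a : forall z, S z -> (b z)%:E <= a).
Hypothesis (S_fin : forall l : R, (0 <= l)%R -> l%:E < a -> H (sublevel S b l) < +oo).
Local Notation F := (extend S a b).

Let mF : measurable_fun setT (F : borel -> \bar R) := measurable_extend a S_borel b_lsc.
Let F0 z : 0 <= F z := extend_ge0 a_ge0 b_ge0 z.

Lemma extend_le z : F z <= a.
Proof. by rewrite /extend; case: ifPn => // /set_mem; exact: b_le_a. Qed.

(** Markov's inequality outside the sublevel set, where the extended cost is at
    least r because r <= a. *)
Lemma hausdorff1_le_sublevel (D : set V) (r : R) : measurable (D : set borel) ->
  (0 < r)%R -> r%:E <= a ->
  H D <= H (sublevel S b r) + (r^-1)%:E * \int[hausdorff1_measure]_(z in D) F z.
Proof.
move=> mD r0 ra.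
have mSr : measurable (sublevel S b r : set borel) by exact: (measurable_sublevel a S_borel b_lsc).
have mDS : measurable (D `\` sublevel S b r : set borel) by exact: (@measurableD _ borel).
apply: (@le_trans _ _ (H (sublevel S b r `|` (D `\` sublevel S b r)))).
  apply: le_hausdorff1 => z Dz.
  by have [|nS] := pselect (sublevel S b r z); [left|right].
apply: le_trans (outer_measureU2 _ _ _) _; apply: leeD => //.
rewrite -lee_pdivrMl ?invr_gt0// invrK.
apply: (@le_trans _ _ (\int[hausdorff1_measure]_(z in D `\` sublevel S b r) cst r%:E z)).
  rewrite integral_cst//; exact: borel_caratheodory.
apply: ge0_subset_le_integral.
- exact: subDsetl.
- by move=> z _; exact: F0.
- by move=> z _; rewrite lee_fin ltW.
move=> z [_ nSz]; rewrite /extend; case: ifPn => // /set_mem Sz.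
by rewrite lee_fin leNgt; apply/negP => br; apply: nSz; split => //; exact: ltW.
Qed.

Section arc.
Variables (E : set V) (x y : V) (l : R) (psi : R -> V).
Hypotheses (E_cube : E `<=` cube) (pc : curve E x y l psi) (pH : H (psi @` I01) = l%:E).

Let pl : elipschitz l psi. Proof. by case: pc. Qed.

(** The reverse of the inequality valid for all paths: the arc has constant speed
    l, and |psi'| <= l everywhere. *)
Lemma arc_path_cost : path_cost S a b psi <= image_cost S a b psi.
Proof.
rewrite /image_cost (constant_speed_integral pc mF F0 pH).
have l0 := elipschitz_ge0 pl.
rewrite -ge0_integralZl//; last exact: measurable_funTS (measurable_along_curve pc mF).
apply: ge0_subset_le_integral => //.
- by move=> t _; rewrite mule_ge0 ?lee_fin.
- by move=> t _; rewrite mule_ge0// lee_fin enorm_ge0.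
- by move=> t _; rewrite muleC lee_wpmul2r// lee_fin enorm_derive1_le.
Qed.

Lemma arc_len : len psi <= l%:E.
Proof.
apply: (@le_trans _ _ (\int[mu]_(t in I01) cst l%:E t)).
  apply: ge0_subset_le_integral => //.
  - by move=> t _; rewrite lee_fin (elipschitz_ge0 pl).
  - by move=> t _; rewrite lee_fin enorm_ge0.
  - by move=> t _; rewrite lee_fin enorm_derive1_le.
apply: (@le_trans _ _ (l%:E * mu I01)); first by rewrite integral_cst//; exact: measurable_I01.
by rewrite lebesgue_measure_I01 mule1.
Qed.

(** The path cost of psi is squeezed between d(x, y), a lower bound of the image
    costs and so of the path costs, and the image cost of psi. *)
Lemma arc_is_minimizer : image_cost S a b psi <= urban_metric S a b x y ->
  is_minimizer S a b x y psi.
Proof.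
move=> pd; have pxy := curve_lip_paths E_cube pc.
have cost_le h : lip_paths x y h -> urban_metric S a b x y <= path_cost S a b h.
  move=> hxy; apply: le_trans (lip_path_integral_le hxy mF F0).
  by apply: ereal_inf_lbound; exists h.
have pcost := le_trans arc_path_cost pd.
split; [exact: pxy| |move=> h hxy; exact: le_trans pcost (cost_le h hxy)].
by apply: le_anti; rewrite pcost cost_le.
Qed.

End arc.

Lemma exists_arc_in_path x y g : lip_paths x y g -> exists l psi,
  [/\ curve cube x y l psi, x <> y -> set_inj I01 psi, H (psi @` I01) = l%:E &
      image_cost S a b psi <= image_cost S a b g].
Proof.
move=> gxy; have [L [gL gc gcube g0 g1]] := lip_paths_curve gxy.
set E := (g \o clamp) @` I01.
have cE : compact E.
  apply: continuous_compact; last exact: segment_compact.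
  by apply: continuous_subspaceT; exact: elipschitz_continuous gL.
have gE : curve E x y L (g \o clamp).
  by split => // t; rewrite gc; exists (clamp t) => //; exact: clamp01.
have [l [psi [pc pinj pH]]] := exists_arc cE gE.
exists l, psi; split => //.
  by case: pc => *; split => // t; have [s _ <-] : E (psi t) by []; exact: gcube.
rewrite /image_cost -(path_image_clamp g).
apply: ge0_subset_le_integral => //.
by move=> _ [t _ <-]; case: pc => _ _ + _ _; apply.
Qed.

Section limit.
Variables (x y : V) (L : nat -> R) (f : nat -> R -> V) (l : R) (g : R -> V).
Hypotheses (fc : forall k, curve cube x y (L k) (f k)) (gc : curve cube x y l g).
Hypotheses (Ll : L k @[k --> \oo] --> l) (fg : forall t, f k t @[k --> \oo] --> g t).
Hypothesis fH : forall k, H (f k @` I01) = (L k)%:E.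

(** If g t is in the open set O then so is f_k t for large k.  By continuity from
    below, the set of times with f_k t in O for all k >= N almost exhausts the
    preimage of O under g when N is large; and L_k tends to l. *)
Lemma curve_measure_open_lsc (O : set V) (e : R) : open O -> (0 < e)%R ->
  \forall k \near \oo, curve_measure gc O <= curve_measure (fc k) O + e%:E.
Proof.
move=> oO e0.
have l0 : (0 <= l)%R by case: gc => /elipschitz_ge0.
have L0 k : (0 <= L k)%R by case: (fc k) => /elipschitz_ge0.
have mpre E' L' h : curve E' x y L' h ->
    measurable (h @^-1` O `&` I01 : set (measurableTypeR R)).
  move=> [hL _ _ _ _]; apply: measurableI; last exact: measurable_itv.
  by apply: open_measurable; move/continuousP : (elipschitz_continuous hL); apply.
pose A k : set (measurableTypeR R) := f k @^-1` O `&` I01.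
pose A' : set (measurableTypeR R) := g @^-1` O `&` I01.
have mA k : measurable (A k) by exact: mpre (fc k).
have mA' : measurable A' by exact: mpre gc.
have mu1 (X : set (measurableTypeR R)) : measurable X -> X `<=` I01 -> mu X <= 1.
  move=> mX XI; apply: (@le_trans _ _ (mu I01)); last by rewrite lebesgue_measure_I01.
  by apply: le_measure; rewrite ?inE//; exact: measurable_I01.
have AI k : A k `<=` I01 by exact: subIsetr.
have muA_fin k : mu (A k) \is a fin_num.
  by rewrite ge0_fin_numE// (le_lt_trans (mu1 _ (mA k) (AI k)))// ltry.
have muA'_fin : mu A' \is a fin_num.
  by rewrite ge0_fin_numE// (le_lt_trans (mu1 _ mA' _))// ?ltry//; exact: subIsetr.
(* The times at which all f_k with k >= N lie in O. *)
pose B N : set (measurableTypeR R) := \bigcap_(k in [set k | (N <= k)%N]) A k.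
have mB N : measurable (B N) by apply: bigcap_measurableType => k _; exact: mA.
have mUB : measurable (\bigcup_N B N) by exact: bigcupT_measurable.
have A'B : A' `<=` \bigcup_N B N.
  move=> t [gt t01]; have /fg[N _ fN] : nbhs (g t) O by exact: open_nbhs_nbhs.
  by exists N => // k /= Nk; split => //; exact: fN.
pose e1 := (e / 2 / (l + 1))%R.
have l1 : (0 < l + 1)%R by rewrite ltr_wpDl.
have e10 : (0 < e1)%R by rewrite !divr_gt0.
have limB : mu (B N) @[N --> \oo] --> mu (\bigcup_N B N).
  apply: nondecreasing_cvg_mu => //.
  move=> N M NM; apply/subsetPset => t tB k /= Mk; apply: tB => /=.
  exact: leq_trans NM Mk.
have : mu A' - e1%:E < mu (\bigcup_N B N).
  apply: (@lt_le_trans _ _ (mu A')); last by apply: le_measure; rewrite ?inE.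
  by rewrite -(fineK muA'_fin) -EFinB lte_fin ltrBlDr ltrDl.
move=> muB; have [N muBN] : exists N, mu A' - e1%:E < mu (B N).
  have /limB[N _ BN] : nbhs (mu (\bigcup_N B N)) [set z | mu A' - e1%:E < z].
    by apply: open_nbhs_nbhs; split => //; exact: open_ereal_gt_ereal.
  by exists N; exact: (BN N (leqnn N)).
have e20 : (0 < e / 2)%R by rewrite divr_gt0.
near=> k.
rewrite !curve_measureE.
have Nk : (N <= k)%N by near: k; exact: nbhs_infty_ge.
have lk : (`|l - L k| < e / 2)%R by near: k; move/cvgrPdist_lt : Ll; apply.
have muk : mu A' <= mu (A k) + e1%:E.
  rewrite -leeBlDr//; apply: le_trans (ltW muBN) _.
  by apply: le_measure; rewrite ?inE// => t; apply.
have muk1 := mu1 _ (mA k) (AI k).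
move: muk muk1; rewrite -/(A k) -/A' -(fineK (muA_fin k)) -(fineK muA'_fin).
have := fine_ge0 (measure_ge0 mu (A k)); have := fine_ge0 (measure_ge0 mu A').
move: (fine (mu A')) (fine (mu (A k))) => p q p0 q0.
rewrite -EFinD -!EFinM -EFinD !lee_fin => pq q1.
apply: (@le_trans _ _ (l * (q + e1))%R); first by rewrite ler_wpM2l.
have le1 : (l * e1 <= e / 2)%R.
  by rewrite /e1 mulrCA ler_piMr ?(ltW e20)// ler_pdivrMr// mul1r lerDl.
have : (l * q <= L k * q + e / 2)%R.
  rewrite -lerBlDl -mulrBl; apply: le_trans (ler_wpM2r q0 (ltW (le_lt_trans (ler_norm _) lk))) _.
  by rewrite ler_piMr// ltW.
rewrite mulrDr; lra.
Unshelve. all: by end_near. Qed.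

(** The sublevel set S_r is replaced by a closed subset K with H(S_r \ K) small.
    The complement of K is open, and the arcs f_k spend little mass in S_r \ K,
    uniformly in k, because their mass is the restriction of H. *)
Lemma superlevel_lsc (r e : R) : (0 <= r)%R -> (0 < e)%R ->
  \forall k \near \oo, curve_measure gc [set z | r%:E < F z] <=
    curve_measure (fc k) [set z | r%:E < F z] + e%:E.
Proof.
move=> r0 e0; set U := [set z | r%:E < F z].
have mU : measurable (U : set borel) by exact: (measurable_superlevel a S_borel b_lsc).
have e20 : (0 < e / 2)%R by rewrite divr_gt0.
have [K [clK KU KH]] : exists K : set V, [/\ closed K, K `&` U = set0 &
    H (~` K `\` U) <= (e / 2)%:E].
  (* For r >= a the superlevel set is empty, and S_r may have infinite measure. *)
have [ra|ar] := ltP r%:E a; last first.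
    exists setT; split; first exact: closedT.
      by rewrite setTI -subset0 => z; rewrite /U /= ltNge (le_trans (extend_le z)).
    by rewrite setCT set0D hausdorff10 lee_fin ltW.
  have mS : measurable (sublevel S b r : set borel) by exact: (measurable_sublevel a S_borel b_lsc).
  have trfin : hausdorff1_trace mS setT < +oo.
    by rewrite /= /hausdorff1_trace setTI; exact: S_fin.
  have UC : ~` U `<=` sublevel S b r.
    move=> z nU; have [Sz|nSz] := pselect (S z).
      by split => //; rewrite leNgt; apply/negP => rb; apply: nU; rewrite /U /= /extend mem_set.
    by exfalso; apply: nU; rewrite /U /= /extend memNset.
  have [K [clK KS KH]] := closed_inner_regular trfin mS e20.
  exists K; split => //.
    rewrite -subset0 => z [/KS [Sz bz] Uz]; move: Uz.
    by rewrite /U /= /extend mem_set// lte_fin ltNge bz.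
  apply: le_trans KH; apply: le_hausdorff1 => z [nK nU].
  by split; [split => //|]; exact: UC.
have := curve_measure_open_lsc (closed_openC clK) e20.
apply: filterS => k hk.
have mK : measurable (~` K : set borel) by apply: measurable_open; exact: closed_openC.
have mKU : measurable (~` K `\` U : set borel) by exact: (@measurableD _ borel).
apply: (@le_trans _ _ (curve_measure gc (~` K))).
  apply: le_measure; rewrite ?inE// => z Uz Kz.
  by have : (K `&` U) z by []; rewrite KU.
apply: le_trans hk _; rewrite [leRHS](_ : _ = curve_measure (fc k) U + (e / 2)%:E + (e / 2)%:E); last first.
  by rewrite -addeA -EFinD -splitr.
apply: leeD => //.
apply: (@le_trans _ _ (curve_measure (fc k) (U `|` (~` K `\` U)))).
  apply: le_measure; rewrite ?inE//; first exact: (@measurableU _ borel).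
  by move=> z nK; have [|nU] := pselect (U z); [left|right].
apply: le_trans (measureU2 _ mU mKU) _; apply: leeD => //.
apply: (@le_trans _ _ ((L k)%:E * mu (f k @^-1` (~` K `\` U) `&` I01))); first exact: lexx.
rewrite -(constant_speed_preimage (fc k) (fH k) mKU).
by apply: le_trans KH; apply: le_hausdorff1; exact: subIsetl.
Qed.

(** The limit g need not have constant speed, but only an upper bound of its image
    cost by its curve measure is needed; for the arcs f_k the two agree. *)
Lemma limit_image_cost (c : R) :
  (forall k, image_cost S a b (f k) <= (c + k.+1%:R^-1)%:E) -> image_cost S a b g <= c%:E.
Proof.
move=> fcost; apply: le_trans (curve_integral_le gc mF F0) _.
rewrite -(integral_curve_measure gc mF F0).
apply: (le_integral_layers mF F0 superlevel_lsc) => k.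
rewrite (integral_curve_measure (fc k) mF F0) -(constant_speed_integral (fc k) mF F0 (fH k)).
exact: fcost.
Qed.

End limit.

(** The direct method.  Choose minimizing arcs, bound their lengths by a level
    r < a, and pass to the limit.  If a = 0 there is no such level, but then
    all costs vanish. *)
Lemma exists_optimal_path x y : urban_metric S a b x y \is a fin_num ->
  exists2 g, lip_paths x y g & image_cost S a b g <= urban_metric S a b x y.
Proof.
move=> dfin.
have adherent (e : R) : (0 < e)%R -> exists2 g, lip_paths x y g &
    image_cost S a b g < urban_metric S a b x y + e%:E.
  by move=> e0; have [_ [g gxy <-] ge] := lb_ereal_inf_adherent e0 dfin; exists g.
have [a0|a_neq0] := eqVneq a 0.
  have [g gxy _] := adherent 1%R ltr01; exists g => //.
  apply: (@le_trans _ _ 0).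
    rewrite /image_cost integral0_eq// => z _; apply: le_anti.
    by rewrite F0 andbT -[leRHS]a0 extend_le.
  apply: le_ereal_inf_tmp => _ [h _ <-]; apply: integral_ge0 => z _; exact: F0.
have [r [r0 ra]] : exists r : R, (0 < r)%R /\ r%:E < a.
  case: (a) a_ge0 a_neq0 => [q| |//]; last by exists 1%R; rewrite ltry.
  rewrite lee_fin eqe => q0 qn0; exists (q / 2)%R.
  have q_gt0 : (0 < q)%R by rewrite lt_neqAle eq_sym qn0.
  by rewrite divr_gt0// lte_fin ltr_pdivrMr// ltr_pMr// ltr1n.
pose c := fine (urban_metric S a b x y).
have cE : urban_metric S a b x y = c%:E by rewrite fineK.
have /choice[L /choice[f fP]] : forall k, exists l psi,
    [/\ curve cube x y l psi, H (psi @` I01) = l%:E &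
        image_cost S a b psi <= (c + k.+1%:R^-1)%:E].
  move=> k; have k0 : (0 < k.+1%:R^-1 :> R)%R by rewrite invr_gt0.
  have [g gxy gk] := adherent _ k0.
  have [l [psi [pc _ pH pg]]] := exists_arc_in_path gxy.
  exists l, psi; split => //; apply: le_trans pg _.
  by rewrite EFinD -cE ltW.
have fc k : curve cube x y (L k) (f k) by case: (fP k).
have fH k : H (f k @` I01) = (L k)%:E by case: (fP k).
have fcost k : image_cost S a b (f k) <= (c + k.+1%:R^-1)%:E by case: (fP k).
pose M := (fine (H (sublevel S b r)) + r^-1 * (c + 1))%R.
have Hfin : H (sublevel S b r) \is a fin_num.
  by rewrite ge0_fin_numE ?hausdorff1_ge0// S_fin// ltW.
have LM k : (L k <= M)%R.
  have mD : measurable (f k @` I01 : set borel).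
    apply: measurable_closed; apply: closed_path_image.
    by case: (fc k) => /elipschitz_continuous.
  rewrite -lee_fin -fH; apply: le_trans (hausdorff1_le_sublevel mD r0 (ltW ra)) _.
  rewrite /M EFinD fineK// EFinM; apply: leeD => //.
  rewrite lee_wpmul2l ?lee_fin ?invr_ge0 ?(ltW r0)//; apply: le_trans (fcost k) _.
  by rewrite lee_fin lerD2l invf_le1// ler1n.
have L0M k : (0 <= L k <= M)%R.
  by rewrite LM andbT; case: (fc k) => /elipschitz_ge0.
(* One subsequence makes the lengths converge, a further one the curves. *)
have [s [l [sk Ls]]] := cvg_subsequence L0M.
have [s' [g [s'k gc fg]]] := curve_subsequence compact_cube (fun k => fc (s k)) (fun k => LM (s k)) Ls.
have s'oo : s' k @[k --> \oo] --> \oo.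
  by move=> A [N _ NA]; exists N => // k /= Nk; apply: NA => /=; exact: leq_trans (s'k k).
exists g; first exact: curve_lip_paths (@subset_refl _ _) gc.
rewrite cE; apply: (limit_image_cost (fun k => fc (s (s' k))) gc _ fg (fun k => fH (s (s' k)))).
- exact: (cvg_comp _ _ s'oo Ls).
- move=> k; apply: le_trans (fcost _) _; rewrite lee_fin lerD2l lef_pV2 ?posrE// ler_nat ltnS.
  exact: leq_trans (s'k k) (sk (s' k)).
Qed.

Lemma exists_arc_minimizer x y : urban_metric S a b x y \is a fin_num ->
  exists l psi, [/\ is_minimizer S a b x y psi, curve cube x y l psi,
    x <> y -> set_inj I01 psi, H (psi @` I01) = l%:E &
    image_cost S a b psi <= urban_metric S a b x y].
Proof.
move=> dfin; have [g gxy gd] := exists_optimal_path dfin.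
have [l [psi [pc pinj pH pg]]] := exists_arc_in_path gxy.
have pd := le_trans pg gd.
exists l, psi; split; [|exact: pc|exact: pinj|exact: pH|exact: pd].
exact: arc_is_minimizer (@subset_refl _ _) pc pH pd.
Qed.

Lemma arc_len_le x y l psi (r : R) : (0 < r)%R -> r%:E <= a ->
  curve cube x y l psi -> H (psi @` I01) = l%:E ->
  image_cost S a b psi <= urban_metric S a b x y ->
  len psi <= H (sublevel S b r) + (r^-1)%:E * urban_metric S a b x y.
Proof.
move=> r0 ra pc pH pd; apply: le_trans (arc_len pc) _; rewrite -pH.
have mD : measurable (psi @` I01 : set borel).
  apply: measurable_closed; apply: closed_path_image.
  by case: pc => /elipschitz_continuous.
apply: le_trans (hausdorff1_le_sublevel mD r0 ra) _; apply: leeD => //.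
by rewrite lee_wpmul2l ?lee_fin ?invr_ge0 ?(ltW r0).
Qed.

End urban.

(** * The minimizer *)

Unset Implicit Arguments.
Set Strict Implicit.
Set Printing Implicit Defensive.
Local Open Scope ereal_scope.

Theorem proposition2p2p2 (R : realType) (n : nat)
    (S : set 'rV[R]_n) (a : \bar R) (b : 'rV[R]_n -> R)
    (S_cube : S `<=` cube)
    (S_rect : countably_1_rectifiable S)
    (S_borel : <<s @open 'rV[R]_n >> S)
    (a_ge0 : 0 <= a)
    (b_ge0 : forall z, S z -> (0 <= b z)%R)
    (b_lsc : lower_semicontinuous (fun z : subspace S => (b z)%:E))
    (b_le_a : forall z, S z -> (b z)%:E <= a)
    (S_fin : forall l : R, (0 <= l)%R -> l%:E < a ->
      hausdorff1 (sublevel S b l) < +oo)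
    (x y : 'rV[R]_n) (x_cube : cube x) (y_cube : cube y)
    (d_fin : urban_metric S a b x y \is a fin_num) :
  exists psi : R -> 'rV[R]_n,
    [/\ is_minimizer S a b x y psi,
        x <> y -> set_inj `[0%R, 1%R] psi,
        a = +oo ->
          len psi <= hausdorff1 (sublevel S b 1) + urban_metric S a b x y &
        forall r : R, a = r%:E -> (0 < r)%R ->
          len psi <= hausdorff1 (sublevel S b (r / 2)) +
                     (2 / r)%:E * urban_metric S a b x y].
Proof.
have [l [psi [pmin pc pinj pH pd]]] :=
  exists_arc_minimizer S_borel a_ge0 b_ge0 b_lsc b_le_a S_fin d_fin.
exists psi; split; [exact: pmin|exact: pinj|move=> aoo|move=> r ar r0].
  have := arc_len_le S_borel a_ge0 b_ge0 b_lsc ltr01 _ pc pH pd.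
  by rewrite invr1 mul1e; apply; rewrite aoo leey.
have r20 : (0 < r / 2)%R by rewrite divr_gt0.
have := arc_len_le S_borel a_ge0 b_ge0 b_lsc r20 _ pc pH pd.
by rewrite invf_div; apply; rewrite ar lee_fin ler_pdivrMr// ler_pMr// ler1n.
Qed.
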